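(* Let $n\ge 2$ be an integer and let $p,q$ be positive real numbers with $p\neq q$. Then there exists a unilateral lattice tiling of $\mathbb{R}^n$ by hypercubes of side lengths $p$ and $q$, and it is unique up to symmetries: any two unilateral lattice tilings of $\mathbb{R}^n$ by hypercubes of side lengths $p$ and $q$ are mapped onto each other by an isometry of $\mathbb{R}^n$.
   Context: A tiling of $\mathbb{R}^n$ is a family of closed sets (tiles) whose union is $\mathbb{R}^n$ and whose pairwise intersections have Lebesgue measure zero. All hypercubes are closed and axis-parallel. A lattice tiling of $\mathbb{R}^n$ by hypercubes of side lengths $p$ and $q$ is a tiling whose tiles are exactly the sets $S_0+\lambda$ and $T_0+\lambda$, $\lambda\in\Lambda$, where $\Lambda=B\mathbb{Z}^n$ for an invertible real $n\times n$ matrix $B$, $S_0$ is a hypercube of side length $p$ and $T_0$ is a hypercube of side length $q$ (so the centers of the tiles of each size form a translate of the lattice $\Lambda$). A tiling by hypercubes is unilateral if no two distinct tiles of the same side length share a full facet. *)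

(* Defs.v *)
From HB Require Import structures.
From mathcomp Require Import all_boot all_order all_algebra.
From mathcomp Require Import boolp classical_sets reals.
Set Implicit Arguments. Unset Strict Implicit. Unset Printing Implicit Defensive.
Import Order.TTheory GRing.Theory Num.Theory.
Local Open Scope ring_scope.
Local Open Scope classical_set_scope.

Section Defs.
Variables (R : realType) (n : nat).
Notation pt := 'cV[R]_n.

Definition box (l u : pt) : set pt :=
  [set x | forall i : 'I_n, l i 0 <= x i 0 <= u i 0].
Definition box_vol (l u : pt) : R := \prod_(i < n) (u i 0 - l i 0).

Definition lebesgue_null (A : set pt) : Prop :=
  forall eps : R, 0 < eps ->
    exists l u : nat -> pt,
      (forall k (i : 'I_n), l k i 0 <= u k i 0) /\
      A `<=` \bigcup_k box (l k) (u k) /\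
      (forall N, \sum_(k < N) box_vol (l k) (u k) <= eps).

Definition closed_set (A : set pt) : Prop :=
  forall x : pt, ~ A x -> exists r : R, 0 < r /\
    forall y : pt, (forall i : 'I_n, `|y i 0 - x i 0| < r) -> ~ A y.

Definition is_tiling (F : set (set pt)) : Prop :=
  (forall C, F C -> closed_set C) /\
  (forall x : pt, exists C, F C /\ C x) /\
  (forall C D, F C -> F D -> C <> D -> lebesgue_null (C `&` D)).

Definition cube (a : pt) (s : R) : set pt :=
  [set x | forall i : 'I_n, a i 0 <= x i 0 <= a i 0 + s].

Definition is_cube (s : R) (C : set pt) : Prop := exists a, C = cube a s.

Definition translate (C : set pt) (v : pt) : set pt := [set x + v | x in C].

Definition lattice (B : 'M[R]_n) : set pt :=
  [set B *m (\col_i (z i)%:~R) | z in [set: 'I_n -> int]].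

Definition cube_facet (a : pt) (s : R) (i : 'I_n) (e : bool) : set pt :=
  [set x | cube a s x /\ x i 0 = a i 0 + (if e then s else 0)].

Definition is_facet_of (C f : set pt) : Prop :=
  exists a s i e, 0 < s /\ C = cube a s /\ f = cube_facet a s i e.

Definition share_facet (C D : set pt) : Prop :=
  exists f, is_facet_of C f /\ is_facet_of D f.

Definition lattice_cube_tiling (p q : R) (F : set (set pt)) : Prop :=
  exists (B : 'M[R]_n) (S0 T0 : set pt),
    B \in unitmx /\ is_cube p S0 /\ is_cube q T0 /\
    F = [set C | exists2 v, lattice B v &
                   C = translate S0 v \/ C = translate T0 v] /\
    is_tiling F.

Definition unilateral (F : set (set pt)) : Prop :=
  forall (s : R) C D, F C -> F D -> C <> D -> is_cube s C -> is_cube s D ->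
    ~ share_facet C D.

Definition sqdist (x y : pt) : R := \sum_(i < n) (x i 0 - y i 0) ^+ 2.

Definition euclid_isometry (f : pt -> pt) : Prop :=
  forall x y, sqdist (f x) (f y) = sqdist x y.

Definition maps_tiling (f : pt -> pt) (F G : set (set pt)) : Prop :=
  [set f @` C | C in F] = G.

End Defs.

(* Main.v *)
Require Import Defs.
From HB Require Import structures.
From mathcomp Require Import all_boot all_order all_algebra all_fingroup.
From mathcomp Require Import boolp classical_sets reals.
From mathcomp Require Import ring lra zify.
Import Order.TTheory GRing.Theory Num.Theory.
Local Open Scope ring_scope.
Local Open Scope classical_set_scope.

(* By symmetry let q < p.

   Existence.  Take the lattice of the vectors with entries p m_j - q m_(j+1),
   where m_0, ..., m_n are integers with m_n = - m_0.  For a point x and any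
   integer m_n, division with remainder by p determines m_(n-1), ..., m_0 such
   that x_j lies in [0, p) + p m_j - q m_(j+1).  Raising m_n by 1 raises m_0 by 0
   or 1, so m_0 + m_n either takes the value -1, and x lies in exactly one p-cube,
   or jumps from -2 to 0, and x lies in exactly one q-cube.

   Uniqueness.  Nonzero lattice vectors have sup-norm at least p, so q-cubes do
   not touch each other.  Let a = (p+q)/2 and b = (p-q)/2, and let the origin be
   the center of a q-cube.  Walking around the q-cube in each coordinate plane
   shows that each facet is covered by one p-cube, the centers of these p-cubes
   being +-u_i with (u_i)_i = a and (u_i)_j = -(u_j)_i = +-b.  The signs form a
   tournament at each vertex of the q-cube, in which no coordinate dominates
   a 3-cycle.  At the q-cube's vertex where coordinate 0 dominates all others the
   tournament is thus transitive; sorting the coordinates maps the u_i to those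
   of the standard tiling, which is therefore contained in, hence equal to, the
   given one up to a signed permutation and a translation. *)

(** * Null sets: boxes with positive edges are not null, flat boxes are *)

(** Continuity of a product in a common increment of its factors; it lets each box of a covering be
    thickened at a prescribed cost in volume. *)
Lemma prod_enlarge (R : realFieldType) (I : Type) (s : seq I) (d : I -> R) e :
  (forall i, 0 <= d i) -> 0 < e ->
  exists2 h, 0 < h & forall h', 0 <= h' -> h' <= h ->
    \prod_(i <- s) (d i + h') <= \prod_(i <- s) d i + e.
Proof.
move=> d0; elim: s e => [|i s IH] e e0.
  by exists 1 => // h' _ _; rewrite !big_nil lerDl ltW.
set D := \prod_(j <- s) d j.
have D0 : 0 <= D by apply: prodr_ge0.
have di := d0 i.
have [h h0 Hh] := IH (e / (2 * (d i + 1))) ltac:(apply: divr_gt0 => //; lra).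
have [h1 h10 Hh1] : exists2 h1, 0 < h1 & h1 * (D + e) <= e / 2.
  exists (e / 2 / (D + e)); first by apply: divr_gt0; lra.
  by rewrite divfK //; lra.
exists (Num.min (Num.min h h1) 1); first by rewrite !lt_min h0 h10 ltr01.
move=> h' h'0; rewrite !le_min => /andP[/andP[hh hh1] h'1].
rewrite !big_cons -/D.
have := Hh _ h'0 hh; rewrite -/D; set Q := \prod_(j <- s) _ => QD.
have Q0 : 0 <= Q by apply: prodr_ge0 => j _; rewrite addr_ge0.
have E : (d i + 1) * (e / (2 * (d i + 1))) = e / 2 by field; lra.
have e' : e / (2 * (d i + 1)) <= e.
  by rewrite ler_pdivrMr; nra.
have : d i * Q <= d i * D + e / 2.
  have : d i * Q <= d i * (D + e / (2 * (d i + 1))) by rewrite ler_wpM2l.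
  have : 0 < e / (2 * (d i + 1)) by apply: divr_gt0; lra.
  by move: E; set g := e / (2 * _) => E *; nra.
have : h' * Q <= h' * (D + e) by rewrite ler_wpM2l //; lra.
have : h' * (D + e) <= h1 * (D + e) by rewrite ler_wpM2r //; lra.
rewrite mulrDl; lra.
Qed.

Lemma overlap1_cut (R : realDomainType) (l u L U t : R) :
  l <= u -> L <= t -> t <= U ->
  Num.max 0 (Num.min u U - Num.max l L) =
  Num.max 0 (Num.min u t - Num.max l L) + Num.max 0 (Num.min u U - Num.max l t).
Proof.
move=> lu Lt tU.
case: (leP u t) => ut.
  rewrite (min_idPl (le_trans ut tU)).
  have -> : Num.max 0 (u - Num.max l t) = 0.
    by apply/max_idPl; rewrite subr_le0 le_max ut orbT.
  by rewrite addr0.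
case: (leP l t) => lt.
  set a := Num.max l L; set b := Num.min u U.
  have at_ : a <= t by rewrite /a ge_max lt Lt.
  have tb : t <= b by rewrite /b le_min tU ltW.
  have ab : a <= b := le_trans at_ tb.
  have E (y z : R) : z <= y -> Num.max 0 (y - z) = y - z.
    by move=> zy; apply/max_idPr; rewrite subr_ge0.
  rewrite (E b a) // (E t a) // (E b t) //; ring.
have -> : Num.max 0 (t - Num.max l L) = 0.
  by apply/max_idPl; rewrite subr_le0 le_max (ltW lt).
by rewrite add0r (max_idPl (le_trans Lt (ltW lt))).
Qed.

Section NonNull.
Context {R : realType} {n : nat}.
Implicit Types (x l u L U : 'cV[R]_n).

(** The volume of the intersection of two boxes; truncating at 0 keeps an even number of negative
    factors from giving a positive product. *)
Definition overlap l u L U : R :=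
  \prod_(i < n) Num.max 0 (Num.min (u i 0) (U i 0) - Num.max (l i 0) (L i 0)).

Definition upd x (i : 'I_n) (t : R) : 'cV[R]_n :=
  \col_j (if j == i then t else x j 0).

Lemma overlap_ge0 l u L U : 0 <= overlap l u L U.
Proof. by apply: prodr_ge0 => i _; rewrite le_max lexx. Qed.

Lemma box_vol_cut L U i t :
  box_vol L U = box_vol L (upd U i t) + box_vol (upd L i t) U.
Proof.
have D1 (F : 'I_n -> R) : \prod_j F j = F i * \prod_(j | j != i) F j.
  by rewrite (bigD1 i).
rewrite /box_vol !D1 /= !mxE eqxx.
set P := \prod_(j < n | j != i) (U j 0 - L j 0).
rewrite (eq_bigr (fun j => U j 0 - L j 0)); last first.
  by move=> j /negPf ji; rewrite !mxE ji.
rewrite [X in _ = _ + _ * X](eq_bigr (fun j => U j 0 - L j 0)); last first.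
  by move=> j /negPf ji; rewrite !mxE ji.
rewrite -/P; ring.
Qed.

Lemma overlap_cut l u L U i t : l i 0 <= u i 0 -> L i 0 <= t <= U i 0 ->
  overlap l u L U = overlap l u L (upd U i t) + overlap l u (upd L i t) U.
Proof.
move=> lu /andP[Lt tU].
have D1 (F : 'I_n -> R) : \prod_j F j = F i * \prod_(j | j != i) F j.
  by rewrite (bigD1 i).
rewrite /overlap !D1 /= !mxE eqxx.
rewrite [X in _ = _ * X + _](eq_bigr (fun j => Num.max 0
  (Num.min (u j 0) (U j 0) - Num.max (l j 0) (L j 0)))); last first.
  by move=> j /negPf ji; rewrite !mxE ji.
rewrite [X in _ = _ + _ * X](eq_bigr (fun j => Num.max 0
  (Num.min (u j 0) (U j 0) - Num.max (l j 0) (L j 0)))); last first.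
  by move=> j /negPf ji; rewrite !mxE ji.
rewrite -mulrDl; congr (_ * _).
exact: overlap1_cut.
Qed.

(* When a cell is cut in two, one half inherits from it that the total overlap
   with the boxes is bounded away from the volume.  Halving forever leads to a
   point of the cell interior to none of the boxes. *)
Definition thin (l u : nat -> 'cV[R]_n) L U : Prop :=
  (forall i, L i 0 < U i 0) /\
  exists2 c, c < box_vol L U & forall N, \sum_(k < N) overlap (l k) (u k) L U <= c.

(** Each half is offered half of the gap [box_vol L U - c]. If both failed, their partial sums up to
    the larger of the two indices would add up to more than [c]. *)
Lemma thin_cut (l u : nat -> 'cV[R]_n) L U i t :
  (forall k i, l k i 0 <= u k i 0) -> L i 0 < t -> t < U i 0 -> thin l u L U ->
  thin l u L (upd U i t) \/ thin l u (upd L i t) U.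
Proof.
move=> lu Lt tU [LU [c cV cS]].
pose d := (box_vol L U - c) / 2.
have d0 : 0 < d by rewrite /d; lra.
have mono L' U' N N' : (N <= N')%N ->
    \sum_(k < N) overlap (l k) (u k) L' U' <= \sum_(k < N') overlap (l k) (u k) L' U'.
  move=> NN'; rewrite -!(big_mkord xpredT (fun k => overlap (l k) (u k) L' U')).
  rewrite [leRHS](big_cat_nat (n := N)) //= lerDl.
  by apply: sumr_ge0 => k _; apply: overlap_ge0.
have [|/existsNP[N1 /negP]] := pselect (forall N,
    \sum_(k < N) overlap (l k) (u k) L (upd U i t) <= box_vol L (upd U i t) - d).
  move=> H; left; split; last by exists (box_vol L (upd U i t) - d) => //; lra.
  by move=> j; rewrite mxE; case: eqP => [->|].
rewrite -ltNge => H1.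
have [|/existsNP[N2 /negP]] := pselect (forall N,
    \sum_(k < N) overlap (l k) (u k) (upd L i t) U <= box_vol (upd L i t) U - d).
  move=> H; right; split; last by exists (box_vol (upd L i t) U - d) => //; lra.
  by move=> j; rewrite mxE; case: eqP => [->|].
rewrite -ltNge => H2; exfalso.
have := cS (maxn N1 N2).
rewrite (eq_bigr (fun k : 'I__ => overlap (l k) (u k) L (upd U i t) +
   overlap (l k) (u k) (upd L i t) U)); last first.
  by move=> k _; apply: overlap_cut; rewrite ?lu ?ltW.
rewrite big_split /=.
have := mono L (upd U i t) _ _ (leq_maxl N1 N2).
have := mono (upd L i t) U _ _ (leq_maxr N1 N2).
have := box_vol_cut L U i t.
move: H1 H2 cV; rewrite /d; lra.
Qed.

Lemma thin_halve (l u : nat -> 'cV[R]_n) L U :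
  (forall k i, l k i 0 <= u k i 0) -> thin l u L U ->
  exists L' U', [/\ thin l u L' U', (forall i, L i 0 <= L' i 0),
    (forall i, U' i 0 <= U i 0) &
    forall i, U' i 0 - L' i 0 <= (U i 0 - L i 0) / 2].
Proof.
move=> lu thLU.
have [L' [U' [th LL UU W]]] : exists L' U', [/\ thin l u L' U',
    (forall i, L i 0 <= L' i 0), (forall i, U' i 0 <= U i 0) &
    forall i, i \in enum 'I_n -> U' i 0 - L' i 0 <= (U i 0 - L i 0) / 2]; last first.
  by exists L', U'; split => // i; apply: W; rewrite mem_enum.
elim: (enum 'I_n) => [|i s [L' [U' [th LL UU W]]]]; first by exists L, U.
have LU' := th.1 i.
have := LL i; have := UU i => UUi LLi.
have [th'|th'] := @thin_cut l u L' U' i ((L' i 0 + U' i 0) / 2) lu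
  ltac:(lra) ltac:(lra) th.
- exists L', (upd U' i ((L' i 0 + U' i 0) / 2)); split => //.
  + by move=> j; rewrite mxE; case: eqP => [->|_]; rewrite ?UU //; lra.
  + move=> j; rewrite inE mxE; case: eqP => [->|_] /=; last exact: W.
    move=> _; lra.
- exists (upd L' i ((L' i 0 + U' i 0) / 2)), U'; split => //.
  + by move=> j; rewrite mxE; case: eqP => [->|_]; rewrite ?LL //; lra.
  + move=> j; rewrite inE mxE; case: eqP => [->|_] /=; last exact: W.
    move=> _; lra.
Qed.

(** The nested cells shrink to a point [x]. Were [x] at depth [eta] in box [k], a late cell of width
    below [eta] would lie in that box, and this single overlap would be the whole volume of the
    cell. *)
Lemma thin_miss (l u : nat -> 'cV[R]_n) L U :
  (forall k i, l k i 0 <= u k i 0) -> thin l u L U ->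
  exists2 x, box L U x & forall k eta, 0 < eta ->
    ~ (forall i, l k i 0 + eta <= x i 0 <= u k i 0 - eta).
Proof.
move=> lu thLU.
pose cell := {c : 'cV[R]_n * 'cV[R]_n | thin l u c.1 c.2}.
pose halved (c d : cell) := [/\ forall i, (sval c).1 i 0 <= (sval d).1 i 0,
    forall i, (sval d).2 i 0 <= (sval c).2 i 0 & forall i,
    (sval d).2 i 0 - (sval d).1 i 0 <= ((sval c).2 i 0 - (sval c).1 i 0) / 2].
have [c|next nextP] := @choice _ _ halved.
  have [L1 [U1 [th1 A1 A2 A3]]] := thin_halve _ _ _ _ lu (svalP c).
  by exists (exist _ (L1, U1) th1).
pose c m : cell := iter m next (exist _ (L, U) thLU).
pose lo m := (sval (c m)).1; pose hi m := (sval (c m)).2.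
have cS m : [/\ forall i, lo m i 0 <= lo m.+1 i 0, forall i, hi m.+1 i 0 <= hi m i 0 &
  forall i, hi m.+1 i 0 - lo m.+1 i 0 <= (hi m i 0 - lo m i 0) / 2] := nextP (c m).
have lohi m i : lo m i 0 < hi m i 0 := (svalP (c m)).1 i.
have loM i m m' : (m <= m')%N -> lo m i 0 <= lo m' i 0.
  elim: m' => [|m' IH]; first by rewrite leqn0 => /eqP ->.
  rewrite leq_eqVlt => /orP[/eqP -> //|/IH H].
  by apply: le_trans H _; case: (cS m').
have hiM i m m' : (m <= m')%N -> hi m' i 0 <= hi m i 0.
  elim: m' => [|m' IH]; first by rewrite leqn0 => /eqP ->.
  rewrite leq_eqVlt => /orP[/eqP -> //|/IH H].
  by apply: le_trans H; case: (cS m').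
(* The widths decay like 2^-m, but this weaker bound already gives a stage of width below [eta]. *)
have wid m i : (hi m i 0 - lo m i 0) * m%:R <= U i 0 - L i 0.
  elim: m => [|m IH]; first by rewrite mulr0 subr_ge0 ltW // thLU.1.
  case: (cS m) => _ _ /(_ i); have := lohi m.+1 i.
  case: m IH => [|m] IH.
    rewrite mulr1 => _ h; apply: le_trans h _.
    by rewrite /lo /hi /=; have := thLU.1 i; lra.
  have : (1 : R) <= m.+1%:R by rewrite ler1n.
  move: IH; rewrite -[m.+2]addn1 natrD.
  set t : R := m.+1%:R; nra.
pose x : 'cV[R]_n := \col_i sup [set lo m i 0 | m in [set: nat]].
have ub i m : ubound [set lo m i 0 | m in [set: nat]] (hi m i 0).
  move=> _ [m' _ <-]; case: (leqP m m') => mm.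
    by apply: le_trans (ltW (lohi m' i)) _; apply: hiM.
  by apply: le_trans (loM i _ _ (ltnW mm)) _; apply: ltW.
have xlo m i : lo m i 0 <= x i 0.
  rewrite mxE; apply: sup_upper_bound; last by exists m.
  by split; [exists (lo 0%N i 0), 0%N|exists (hi 0%N i 0); apply: ub].
have xhi m i : x i 0 <= hi m i 0.
  by rewrite mxE; apply: ge_sup; [exists (lo 0%N i 0), 0%N|apply: ub].
exists x => [i|k eta eta0 Hk]; first by rewrite (xlo 0%N) (xhi 0%N).
pose w := \sum_(i < n) (U i 0 - L i 0).
have wi i : U i 0 - L i 0 <= w.
  rewrite /w (bigD1 i) //= lerDl sumr_ge0 // => j _.
  by rewrite subr_ge0 ltW // thLU.1.
pose m := (Num.truncn (w / eta)).+1.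
have mw : w < eta * m%:R.
  by rewrite mulrC -ltr_pdivrMr // truncnS_gt.
have small i : hi m i 0 - lo m i 0 < eta.
  have : (hi m i 0 - lo m i 0) * m%:R < eta * m%:R.
    by apply: le_lt_trans (wid m i) (le_lt_trans (wi i) mw).
  by rewrite ltr_pM2r // ltr0n.
have [_ [b bV bS]] := svalP (c m).
have := bS k.+1; rewrite big_ord_recr /= -/(lo m) -/(hi m) => bS'.
have : \sum_(i < k) overlap (l i) (u i) (lo m) (hi m) >= 0.
  by apply: sumr_ge0 => i _; apply: overlap_ge0.
suff : overlap (l k) (u k) (lo m) (hi m) = box_vol (lo m) (hi m).
  by move: bV bS'; rewrite -/(lo m) -/(hi m); lra.
apply: eq_bigr => i _.
have := Hk i; have := small i; have := xlo m i; have := xhi m i; have := lohi m i.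
move=> h1 h2 h3 h4 /andP[h5 h6].
rewrite (min_idPr _); last lra.
rewrite (max_idPr (_ : l k i 0 <= _)); last lra.
by apply/max_idPr; lra.
Qed.

(** Take a covering of at most a quarter of the volume. Thickening box k by [h k] costs at most
    another quarter in total, so the thickened boxes leave a point in none of their interiors. That
    point lies in an original box, hence at depth [h k] in the thickened one. *)
Lemma box_not_null L U : (forall i, L i 0 < U i 0) -> ~ lebesgue_null (box L U).
Proof.
move=> LU null.
have V0 : 0 < box_vol L U by apply: prodr_gt0 => i _; rewrite subr_gt0.
pose e := box_vol L U / 4.
have e0 : 0 < e by rewrite /e; lra.
have [l [u [lu [cov vol]]]] := null e e0.
have [k|h hP] := @choice nat R (fun k t => 0 < t /\
    box_vol (l k - const_mx t) (u k + const_mx t) <=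
    box_vol (l k) (u k) + e / 2 ^+ k.+1).
  have ek : 0 < e / 2 ^+ k.+1 by rewrite divr_gt0 // exprn_gt0.
  have [h h0 H] := @prod_enlarge R _ (index_enum 'I_n)
     (fun i => u k i 0 - l k i 0) _ (fun i => ltac:(by rewrite subr_ge0)) ek.
  (* Both ends of every edge move by [h / 2], so the edge grows by [h]. *)
  exists (h / 2); split; first lra.
  have := H h (ltW h0) (lexx _); apply: le_trans.
  rewrite /box_vol le_eqVlt; apply/orP; left; apply/eqP.
  by apply: eq_bigr => i _; rewrite !mxE; lra.
pose l' k := l k - const_mx (h k); pose u' k := u k + const_mx (h k).
have lu' k i : l' k i 0 <= u' k i 0.
  by rewrite !mxE; have := lu k i; have := (hP k).1; lra.
have geo N : \sum_(k < N) e / 2 ^+ k.+1 <= e.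
  suff -> : \sum_(k < N) e / 2 ^+ k.+1 = e - e / 2 ^+ N.
    by rewrite gerBl divr_ge0 ?ltW // exprn_gt0.
  elim: N => [|N IH]; first by rewrite big_ord0 expr0 divr1 subrr.
  rewrite big_ord_recr /= IH exprS.
  by field; rewrite ?expf_neq0 ?pnatr_eq0.
have [|x /cov [k _ kx] xout] := thin_miss l' u' L U lu'.
  split=> //; exists (e + e); first by rewrite /e; lra.
  move=> K; apply: (@le_trans _ _ (\sum_(k < K) (box_vol (l k) (u k) + e / 2 ^+ k.+1))).
    apply: ler_sum => k _; apply: le_trans (hP k).2.
    apply: ler_prod => i _; rewrite le_max lexx /=.
    have := lu' k i; rewrite /l' /u' => luk.
    rewrite ge_max subr_ge0 luk /= lerB //.
      by rewrite ge_min lexx.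
    by rewrite le_max lexx.
  rewrite big_split /=. by apply: lerD (vol K) (geo K).
apply: (xout k (h k) (hP k).1) => i; rewrite !mxE subrK addrK.
exact: kx.
Qed.

Lemma flat_box_null L U i : U i 0 <= L i 0 -> lebesgue_null (box L U).
Proof.
move=> UL e e0.
have [LU|/existsNP[j /negP Hj]] := pselect (forall j, L j 0 <= U j 0).
  exists (fun=> L), (fun=> U); split=> //; split; first by move=> x Hx; exists 0%N.
  move=> N; rewrite big1 ?ltW // => k _.
  have E : U i 0 = L i 0 by apply/eqP; rewrite eq_le UL LU.
  by rewrite /box_vol (bigD1 i) //= E subrr mul0r.
(* Here the box is empty; the degenerate box at 0 merely provides a covering family with
   [l <= u]. *)
exists (fun=> 0), (fun=> 0); split=> //; split.
  by move=> x /(_ j) /andP[h1 h2]; case/negP: Hj; exact: le_trans h1 h2.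
move=> N; rewrite big1 ?ltW // => k _.
by rewrite /box_vol (bigD1 i) //= subrr mul0r.
Qed.

End NonNull.

(** * Chains of divisions with remainder *)

Lemma nat_ind_down (P : nat -> Prop) n :
  P n -> (forall j, (j < n)%N -> P j.+1 -> P j) -> forall j, (j <= n)%N -> P j.
Proof.
move=> Pn IH j jn; rewrite -(subKn jn).
elim: (n - j)%N (leq_subr j n) => [_|i IHi lt_in]; first by rewrite subn0.
have n0 : (0 < n)%N by apply: leq_trans lt_in.
apply: IH; first by rewrite ltn_subrL.
by rewrite -subSn // subSS; apply/IHi/ltnW.
Qed.

Section Chain.
Context {R : realType} {N : nat} (p q : R) (q0 : 0 < q) (qp : q < p).
Implicit Types (x : 'cV[R]_N.+1) (m : nat -> int).

(** [m j] is the quotient of [x j 0 + q * m j.+1] by [p], so the entry at [N.+1] determines all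
    lower ones. *)
Definition chain x m : Prop := forall j : 'I_N.+1,
  0 <= x j 0 - (p * (m j)%:~R - q * (m j.+1)%:~R) < p.

Lemma chain_exists x (k : int) : exists2 m, chain x m & m N.+1 = k.
Proof.
(* [back i] is the entry at index [N.+1 - i]. *)
pose back := fix back i : int := if i is i'.+1 then
  Num.floor ((x (inord (N - i')) 0 + q * (back i')%:~R) / p) else k.
exists (fun j => back (N.+1 - j)%N); last by rewrite subnn.
move=> j; have jN : (j <= N)%N by rewrite -ltnS.
rewrite subSn // subSS /= subKn // inord_val.
set y := x j 0 + q * _; have p0 : 0 < p := lt_trans q0 qp.
have := floor_itv (y / p); set f := Num.floor _.
rewrite ler_pdivlMr // ltr_pdivrMr // intrD mulr1z => /andP[h1 h2].
rewrite opprB addrA -/y; lra.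
Qed.

Lemma chain_le x m m' : chain x m -> chain x m' -> m N.+1 <= m' N.+1 ->
  forall j, (j <= N.+1)%N -> m j <= m' j.
Proof.
move=> C C' le; apply: nat_ind_down => // j jN.
have /= /andP[h1 _] := C (Ordinal jN); have /= /andP[_ h2] := C' (Ordinal jN).
rewrite -(ler_int R) -(ler_pM2l q0) => h3.
rewrite -ltzD1 -(ltr_int R) intrD mulr1z -(ltr_pM2l (lt_trans q0 qp)). move: qp; lra.
Qed.

(** Raising [m j.+1] by at most 1 raises the dividend by at most [q < p], hence the quotient by at
    most 1. *)
Lemma chain_le1 x m m' : chain x m -> chain x m' -> m' N.+1 <= m N.+1 + 1 ->
  forall j, (j <= N.+1)%N -> m' j <= m j + 1.
Proof.
move=> C C' le; apply: nat_ind_down => // j jN.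
have /= /andP[_ h1] := C (Ordinal jN); have /= /andP[h2 _] := C' (Ordinal jN).
rewrite -(ler_int R) -(ler_pM2l q0) intrD mulr1z => h3.
rewrite -ltzD1 -(ltr_int R) !intrD !mulr1z -(ltr_pM2l (lt_trans q0 qp)). move: qp; lra.
Qed.

Lemma chain_inj x m m' : chain x m -> chain x m' -> m N.+1 = m' N.+1 ->
  forall j, (j <= N.+1)%N -> m j = m' j.
Proof.
move=> C C' E j jN; apply/eqP; rewrite eq_le.
by apply/andP; split; apply: (chain_le x) => //; rewrite E.
Qed.

(* Raising the last entry of a chain by 1 raises its first entry by 0 or 1, so
   [m 0 + m N.+1] grows in steps of 1 or 2 and skips at most one value. *)
Lemma chain_crossing x :
  (exists2 m, chain x m & m N.+1 = -1 - m 0%N) \/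
  (exists m m', [/\ chain x m, chain x m', m N.+1 = - m 0%N &
     forall j, (j <= N.+1)%N -> m' j = m j - 1]).
Proof.
have [k|M MP] := @choice int (nat -> int) (fun k m => chain x m /\ m N.+1 = k).
  by have [m h1 h2] := chain_exists x k; exists m.
have [h hE] : {h : int -> int | forall k, h k = M k 0%N + k} by exists (fun k => M k 0%N + k).
have hmono k k' : k <= k' -> h k + (k' - k) <= h k'.
  move=> kk; have [c e] := MP k; have [c' e'] := MP k'.
  by have := chain_le x _ _ c c' (ltac:(lia)) 0%N isT; rewrite !hE; lia.
have [K KP] : {K : nat | - K%:Z <= h 0 <= K%:Z}.
  by exists `|h 0|%N; move: (h 0) => t; lia.
(* [h] grows at least as fast as its argument. The shift by [K + 1] starts the search at a negative
   value, so the first nonnegative one has a predecessor [k]. *)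
have ex : exists i : nat, 0 <= h (i%:Z - K%:Z - 1).
  exists (K + K + 1)%N; set k := _ - 1.
  have kK : k = K%:Z by rewrite /k; lia.
  by have := hmono 0 k ltac:(lia); rewrite kK; lia.
case: (ex_minnP ex) => -[|i] hi min.
  exfalso; move: hi; set k := _ - 1; have kK : k = - K%:Z - 1 by rewrite /k; lia.
  by have := hmono k 0 ltac:(lia); rewrite kK; lia.
have lt : h (i%:Z - K%:Z - 1) < 0.
  by rewrite ltNge; apply/negP => /min; rewrite ltnn.
set k := i%:Z - K%:Z - 1 in lt.
have ek : i.+1%:Z - K%:Z - 1 = k + 1 by rewrite /k; lia.
rewrite ek in hi.
have [c e] := MP k; have [c' e'] := MP (k + 1).
have le1 := chain_le1 x _ _ c c' ltac:(lia).
have le0 := chain_le x _ _ c c' ltac:(lia).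
have := le1 0%N isT; have := le0 0%N isT.
case: (eqVneq (h k) (-1)) => hk; first by left; exists (M k) => //; rewrite e; move: hk; rewrite !hE; lia.
move=> a0 a1; right; exists (M (k + 1)), (M k); split => //.
  by rewrite e'; move: lt hi hk; rewrite !hE; lia.
have E0 : M (k + 1) 0%N = M k 0%N + 1 by move: lt hi hk; rewrite !hE; lia.
move=> j jN; have := le1 j jN; have := le0 j jN.
(* The rise at index 0 spreads to all indices: with an unchanged entry at [j.+1] the quotient at [j]
   could not rise. *)
suff : M k j + 1 <= M (k + 1) j by lia.
elim: j jN => [|j IH] jN; first by lia.
have Ej := IH (ltnW jN).
have := c (Ordinal jN); have := c' (Ordinal jN) => /= /andP[h2 _] /andP[_ h1].
rewrite -(ler_int R) !intrD ?mulr1z in Ej.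
rewrite lezD1 -(ltr_int R) -(ltr_pM2l q0).
have : p * ((M k j)%:~R + 1) <= p * (M (k + 1) j)%:~R.
  by rewrite ler_pM2l // (lt_trans q0 qp).
lra.
Qed.

End Chain.

(** * Cubes: separation and facets *)

Section Cubes.
Context {R : realType} {n : nat}.
Implicit Types (a b v x : 'cV[R]_n) (s t : R).

Lemma translate_cube a s v : translate (cube a s) v = cube (a + v) s.
Proof.
apply/seteqP; split => [_ [x Hx <-] i|x Hx]; first by have := Hx i; rewrite !mxE; lra.
by exists (x - v); [move=> i; have := Hx i; rewrite !mxE; lra|rewrite subrK].
Qed.

Lemma cube_closed a s : closed_set (cube a s).
Proof.
move=> x /existsNP[i /negP]; rewrite negb_and -!ltNge => /orP[] h.
  exists (a i 0 - x i 0); split=> [|y /(_ i)]; first by rewrite subr_gt0.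
  by rewrite ltr_norml => /andP[_ h1] /(_ i) /andP[h2 _]; lra.
exists (x i 0 - (a i 0 + s)); split=> [|y /(_ i)]; first by rewrite subr_gt0.
by rewrite ltr_norml => /andP[h1 _] /(_ i) /andP[_ h2]; lra.
Qed.

Lemma cube_sep_null a s b t i :
  a i 0 + s <= b i 0 \/ b i 0 + t <= a i 0 -> lebesgue_null (cube a s `&` cube b t).
Proof.
move=> sep.
pose l : 'cV[R]_n := \col_j Num.max (a j 0) (b j 0).
pose u : 'cV[R]_n := \col_j Num.min (a j 0 + s) (b j 0 + t).
have -> : cube a s `&` cube b t = box l u.
  apply/seteqP; split => [x [xa xb] j|x lu].
    by rewrite !mxE ge_max le_min; move: (xa j) (xb j) => /andP[-> ->] /andP[-> ->].
  by split=> j; have := lu j; rewrite !mxE ge_max le_min => /andP[/andP[h1 h2] /andP[h3 h4]]; apply/andP.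
apply: (flat_box_null _ _ i); rewrite !mxE ge_min !le_max.
by case: sep => ->; rewrite ?orbT.
Qed.

(** This turns the measure condition into inequalities: cubes separated by no coordinate meet in a
    box with positive edges. *)
Lemma cube_null_sep a s b t : 0 < s -> 0 < t ->
  lebesgue_null (cube a s `&` cube b t) ->
  exists i, a i 0 + s <= b i 0 \/ b i 0 + t <= a i 0.
Proof.
move=> s0 t0 null; apply: contrapT => none.
pose l : 'cV[R]_n := \col_j Num.max (a j 0) (b j 0).
pose u : 'cV[R]_n := \col_j Num.min (a j 0 + s) (b j 0 + t).
have lu i : l i 0 < u i 0.
  rewrite !mxE gt_max !lt_min !ltrDl s0 t0 /= andbT.
  by apply/andP; split; rewrite ltNge; apply/negP => h; apply: none; exists i; auto.
apply: (box_not_null l u lu); move=> e /null [l' [u' [H1 [H2 H3]]]].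
exists l', u'; split=> //; split=> // x lux; apply: H2.
by split=> j; have := lux j; rewrite !mxE ge_max le_min => /andP[/andP[h1 h2] /andP[h3 h4]]; apply/andP.
Qed.

End Cubes.

Section Facets.
Context {R : realType} {N : nat}.
Implicit Types (a b v x : 'cV[R]_N.+1) (s t : R).

Lemma cube_inj a s b t : 0 <= s -> cube a s = cube b t -> a = b /\ s = t.
Proof.
move=> s0 E.
have aa : cube a s a by move=> i; rewrite lexx lerDl.
have as_ : cube a s (a + const_mx s) by move=> i; rewrite !mxE lerDl s0 /=.
rewrite E in aa as_.
have t0 : 0 <= t by have := aa ord0; lra.
have bb : cube b t b by move=> i; rewrite lexx lerDl.
have bt : cube b t (b + const_mx t) by move=> i; rewrite !mxE lerDl t0 /=.
rewrite -E in bb bt; split; last first.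
  by have := as_ ord0; have := bt ord0; have := aa ord0; have := bb ord0; rewrite !mxE; lra.
by apply/colP => i; have := aa i; have := bb i; lra.
Qed.

(** A facet is recovered from its extreme corners [lo] and [hi]. In dimension 1 a facet is a point
    and forgets the side length, hence [0 < N]. *)
Lemma cube_facet_inj a s i e b t j f : (0 < N)%N -> 0 < s -> 0 < t ->
  cube_facet a s i e = cube_facet b t j f ->
  [/\ i = j, s = t, forall k, k != i -> a k 0 = b k 0 &
      a i 0 + (if e then s else 0) = b i 0 + (if f then t else 0)].
Proof.
move=> N0 s0 t0 E.
pose lo (c : 'cV[R]_N.+1) r k (g : bool) : 'cV[R]_N.+1 :=
  \col_m (c m 0 + if m == k then if g then r else 0 else 0).
pose hi (c : 'cV[R]_N.+1) r k (g : bool) : 'cV[R]_N.+1 :=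
  \col_m (c m 0 + if m == k then if g then r else 0 else r).
have loP c r k g : 0 < r -> cube_facet c r k g (lo c r k g).
  move=> r0; split; last by rewrite mxE eqxx.
  by move=> m; rewrite mxE; case: eqP; case: g; lra.
have hiP c r k g : 0 < r -> cube_facet c r k g (hi c r k g).
  move=> r0; split; last by rewrite mxE eqxx.
  by move=> m; rewrite mxE; case: eqP; case: g; lra.
have := loP a s i e s0; have := hiP a s i e s0; rewrite E => -[ha1 ha2] [la1 la2].
have := loP b t j f t0; have := hiP b t j f t0; rewrite -E => -[hb1 hb2] [lb1 lb2].
have ij : i = j.
  by apply/eqP; apply: contraT => ij; move: ha2 la2; rewrite !mxE eq_sym (negPf ij); lra.
subst j.
have ab k : k != i -> a k 0 = b k 0 /\ s = t.
  move=> /negPf ki; have := ha1 k; have := la1 k; have := hb1 k; have := lb1 k.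
  by rewrite !mxE ki; split; lra.
have [k ki] : exists k : 'I_N.+1, k != i.
  have [->|i0] := eqVneq i ord0; last by exists ord0; rewrite eq_sym.
  by exists ord_max; rewrite -val_eqE /= -lt0n.
split => //; [exact: (ab k ki).2|by move=> m /ab[]|].
by move: la2; rewrite mxE eqxx.
Qed.

Lemma share_facet_shift a b s : (0 < N)%N -> 0 < s -> a != b ->
  share_facet (cube a s) (cube b s) ->
  exists i, b = a + s *: delta_mx i 0 \/ a = b + s *: delta_mx i 0.
Proof.
move=> N0 s0 ab [f [[a' [s' [i [e [s'0 [Ea Ef]]]]]] [b' [t' [j [e' [t'0 [Eb Ef']]]]]]]].
have [? ?] := cube_inj _ _ _ _ (ltW s0) Ea; subst a' s'.
have [? ?] := cube_inj _ _ _ _ (ltW s0) Eb; subst b' t'.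
have [ij _ abk abi] := cube_facet_inj _ _ _ _ _ _ _ _ N0 s0 s0 (etrans (esym Ef) Ef').
exists i; have D k : (delta_mx i 0 : 'cV[R]_N.+1) k 0 = (k == i)%:R by rewrite mxE eqxx andbT.
have col (c d : 'cV[R]_N.+1) : (forall k, k != i -> c k 0 = d k 0) ->
    d i 0 = c i 0 + s -> d = c + s *: delta_mx i 0.
  move=> cd ci; apply/colP => k; rewrite 2!mxE D.
  have [->|ki] := eqVneq k i; first by rewrite mulr1.
  by rewrite mulr0 addr0 cd.
case: e e' abi {Ef Ef'} => -[] abi.
- case/eqP: ab; apply/colP => k; have [->|/abk//] := eqVneq k i; lra.
- by left; apply: col => //; lra.
- by right; apply: col => [k /abk//|]; lra.
- case/eqP: ab; apply/colP => k; have [->|/abk//] := eqVneq k i; lra.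
Qed.

End Facets.

(** * The standard tiling *)

(** Encodes the closing condition [m_n = - m_0] of the integer sequence; only indices up to [N.+1]
    matter. *)
Definition antiper {V : zmodType} {N} (z : 'I_N.+1 -> V) (k : nat) : V :=
  if (k < N.+1)%N then z (inord k) else - z ord0.

Lemma antiper_ord {V : zmodType} {N} (z : 'I_N.+1 -> V) (j : 'I_N.+1) : antiper z j = z j.
Proof. by rewrite /antiper ltn_ord inord_val. Qed.

Lemma antiper_last {V : zmodType} {N} (z : 'I_N.+1 -> V) : antiper z N.+1 = - z ord0.
Proof. by rewrite /antiper ltnn. Qed.

Lemma antiper_first {V : zmodType} {N} (z : 'I_N.+1 -> V) : antiper z 0 = z ord0.
Proof. exact: (antiper_ord z ord0). Qed.

Section Standard.
Context {R : realType} {N : nat} (p q : R).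
Implicit Types (x : 'cV[R]_N.+1) (z y : 'I_N.+1 -> int).

(** Column k is p e_k - q e_(k-1); wrapping around changes the sign, so column 0 is p e_0 + q
    e_N. *)
Definition std_mx : 'M[R]_N.+1 := \matrix_(j, k)
  (p * (k == j)%:R - q * (nat_of_ord k == j.+1)%:R
   + q * ((nat_of_ord j == N) && (k == ord0))%:R).

Lemma std_mxE (v : 'cV[R]_N.+1) j :
  (std_mx *m v) j 0 = p * antiper (v^~ 0) j - q * antiper (v^~ 0) j.+1.
Proof.
have pick (P : pred 'I_N.+1) c k : (forall i, P i = (i == k)) ->
    \sum_i c * (P i)%:R * v i 0 = c * v k 0.
  move=> Pk; rewrite (bigD1 k) //= Pk eqxx mulr1 big1 ?addr0 // => i /negPf ik.
  by rewrite Pk ik mulr0 mul0r.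
have none (P : pred 'I_N.+1) c : (forall i, P i = false) ->
    \sum_i c * (P i)%:R * v i 0 = 0.
  by move=> P0; rewrite big1 // => i _; rewrite P0 mulr0 mul0r.
rewrite mxE; under eq_bigr => k _ do rewrite mxE mulrDl mulrBl.
rewrite big_split sumrB /= (pick (fun k => k == j) _ j) // antiper_ord.
rewrite -addrA; congr (_ + _); rewrite /antiper; case: ltnP => jN.
  rewrite (pick (fun k => nat_of_ord k == j.+1) _ (inord j.+1)); last first.
    by move=> i; rewrite -val_eqE /= inordK.
  by rewrite none ?addr0 // => i; rewrite (ltn_eqF (jN : (j < N)%N)).
have jE : nat_of_ord j = N by apply/eqP; rewrite eqn_leq -ltnS ltn_ord.
rewrite none => [|i]; last by rewrite jE ltn_eqF.
rewrite (pick (fun k => (nat_of_ord j == N) && (k == ord0)) _ ord0); last first.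
  by move=> i; rewrite jE eqxx.
by rewrite oppr0 add0r mulrN opprK.
Qed.

Definition std_vec z : 'cV[R]_N.+1 := std_mx *m \col_i (z i)%:~R.

Lemma std_vecE z j :
  std_vec z j 0 = p * (antiper z j)%:~R - q * (antiper z j.+1)%:~R.
Proof.
rewrite /std_vec std_mxE; congr (_ * _ - _ * _); rewrite /antiper.
all: by case: ifP => _; rewrite mxE // mulrNz.
Qed.

Lemma std_vecD y z : std_vec (fun i => y i + z i) = std_vec y + std_vec z.
Proof.
by rewrite -mulmxDr; congr (_ *m _); apply/colP => i; rewrite !mxE intrD.
Qed.

Lemma std_vecB y z : std_vec (fun i => y i - z i) = std_vec y - std_vec z.
Proof.
by rewrite -mulmxBr; congr (_ *m _); apply/colP => i; rewrite !mxE intrB.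
Qed.

Lemma std_vec0 : std_vec (fun=> 0) = 0.
Proof.
rewrite /std_vec (_ : \col_i _ = 0) ?mulmx0 //.
by apply/colP => i; rewrite !mxE.
Qed.

(** The chain of a p-cube ends in [-1 - m 0]; the extra -1 contributes [q] to the last coordinate of
    the corner. *)
Definition std_shift : 'cV[R]_N.+1 := \col_j (if j == ord_max then q else 0).

(* [true] stands for the p-cubes, [false] for the q-cubes. *)
Definition std_corner (e : bool) z : 'cV[R]_N.+1 :=
  (if e then std_shift else 0) + std_vec z.

Definition std_side (e : bool) : R := if e then p else q.

(** Half-open cubes make the tiling an exact partition, so covering and disjointness can be checked
    point by point. *)
Definition hcube (a : 'cV[R]_N.+1) (s : R) : set 'cV[R]_N.+1 :=
  [set x | forall i, a i 0 <= x i 0 < a i 0 + s].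

Definition std_tiling : set (set 'cV[R]_N.+1) :=
  [set C | exists2 v, lattice std_mx v &
     C = translate (cube std_shift p) v \/ C = translate (cube 0 q) v].

Lemma std_tilingP C :
  std_tiling C <-> exists e z, C = cube (std_corner e z) (std_side e).
Proof.
split=> [[_ [z _ <-]]|[e [z ->]]].
  by rewrite !translate_cube -/(std_vec z) => -[->|->]; [exists true, z|exists false, z].
exists (std_vec z); first by exists z.
by rewrite !translate_cube; case: e; [left|right].
Qed.

Hypotheses (q0 : 0 < q) (qp : q < p).

(** A kernel vector satisfies p m_j = q m_(j+1), so going around once gives p^(N+1) m_0 = - q^(N+1)
    m_0. *)
Lemma std_mx_unit : std_mx \in unitmx.
Proof.
rewrite -unitmx_tr unitmxE unitfE; apply/negP => /det0P[v v0 vB]; case/negP: v0.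
have {}vB : std_mx *m v^T = 0 by rewrite -[std_mx]trmxK -trmx_mul vB trmx0.
pose m := antiper (v^T^~ 0).
have step j : (j < N.+1)%N -> p * m j = q * m j.+1.
  move=> jN; apply/eqP; rewrite -subr_eq0.
  by rewrite -(std_mxE v^T (Ordinal jN)) vB mxE.
have pow j : (j <= N.+1)%N -> p ^+ j * m 0%N = q ^+ j * m j.
  elim: j => [|j IH] jN; first by rewrite !expr0.
  by rewrite exprS -mulrA IH 1?ltnW // mulrCA step // mulrA -exprSr.
have m0 : m 0%N = 0.
  have := pow N.+1 (leqnn _); rewrite /m antiper_last antiper_first => /eqP.
  rewrite mulrN -subr_eq0 opprK -mulrDl mulf_eq0 => /orP[|/eqP //].
  by rewrite gt_eqF // addr_gt0 // exprn_gt0 // (lt_trans q0).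
apply/eqP/rowP => j; rewrite mxE.
have := pow j (ltnW (ltn_ord j)); rewrite m0 mulr0 /m antiper_ord mxE => /esym/eqP.
by rewrite mulf_eq0 expf_eq0 (gt_eqF q0) andbF => /eqP.
Qed.

Lemma std_cover x : exists e z, hcube (std_corner e z) (std_side e) x.
Proof.
have anti (m : nat -> int) k : (k < N.+1)%N -> antiper (fun i : 'I_N.+1 => m i) k = m k.
  by move=> kN; rewrite /antiper kN inordK.
case: (chain_crossing p q q0 qp x) => [[m C mN]|[m [m' [C C' mN mm]]]].
  exists true, (fun i => m i) => j; have := C j.
  rewrite [std_corner _ _ _ _]mxE std_vecE [std_shift _ _]mxE anti //.
  case: eqP => [->|jm] /=.
    by rewrite antiper_last mN !intrD !mulrNz mulr1z; lra.
  have jN : (j.+1 < N.+1)%N.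
    by rewrite ltnS ltn_neqAle -ltnS ltn_ord andbT; apply/eqP => E; apply/jm/val_inj.
  by rewrite anti //; lra.
(* With [c] the corner coordinate, the chain [m] puts [x j 0] in [c, c + p) and the chain [m - 1]
   puts it in [c - p + q, c + q); together this is [c, c + q). *)
exists false, (fun i => m i) => j; have := C j; have := C' j.
rewrite [std_corner _ _ _ _]mxE std_vecE [(0 : 'cV__) _ _]mxE anti //=.
have -> : antiper (fun i : 'I_N.+1 => m i) j.+1 = m j.+1.
  have [jN|jN] := ltnP j.+1 N.+1; first exact: anti.
  have -> : j.+1 = N.+1 by apply/eqP; rewrite eqn_leq ltn_ord.
  by rewrite antiper_last mN.
rewrite !mm ?ltn_ord 1?ltnW ?ltn_ord // !intrB !mulr1z; lra.
Qed.

Lemma chain_of_p_cube z x : hcube (std_corner true z) p x ->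
  chain p q x (fun k => antiper z k - (k == N.+1)%:Z).
Proof.
move=> H j; have := H j; rewrite [std_corner _ _ _ _]mxE std_vecE [std_shift _ _]mxE.
rewrite (ltn_eqF (ltn_ord j)) subr0 -val_eqE /= eqSS.
by case: eqP => _; rewrite ?subr0 ?intrB ?mulr1z; lra.
Qed.

Lemma chain_of_q_cube z x : hcube (std_corner false z) q x ->
  chain p q x (antiper z) /\ chain p q x (fun k => antiper z k - 1).
Proof.
move=> H; have qp' := qp.
by split=> j; have := H j; rewrite [std_corner _ _ _ _]mxE std_vecE mxE ?intrB ?mulr1z; lra.
Qed.

(** Among the chains of x, the sum of first and last entry strictly increases with the last entry.
    It is -1 for a p-cube, but 0 and -2 for the two consecutive chains of a q-cube, which leave no
    room between them. Equal sums give equal chains. *)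
Lemma std_disjoint x e z f y :
  hcube (std_corner e z) (std_side e) x -> hcube (std_corner f y) (std_side f) x ->
  e = f /\ z = y.
Proof.
have Slast z' : antiper z' N.+1 - (N.+1 == N.+1)%:Z = -1 - (antiper z' 0%N - (0%N == N.+1)%:Z).
  by rewrite eqxx antiper_last antiper_first; lia.
have Tlast z' : antiper z' N.+1 = - antiper z' 0%N by rewrite antiper_last antiper_first.
have mixed z' y' : hcube (std_corner true z') p x -> hcube (std_corner false y') q x -> False.
  move=> /chain_of_p_cube C /chain_of_q_cube[D D'].
  have := Slast z'; have := Tlast y'.
  have := chain_le p q q0 qp x _ _ D C; have := chain_le p q q0 qp x _ _ C D'.
  move=> /(_ _ 0%N isT) h1 /(_ _ 0%N isT) h2; lia.
have fin z' y' : (forall j, (j <= N.+1)%N -> antiper z' j = antiper y' j) -> z' = y'.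
  move=> E; apply/funext => i; rewrite -(antiper_ord z') -(antiper_ord y').
  exact: E (ltnW (ltn_ord i)).
case: e f => -[] /=.
- move=> /chain_of_p_cube C /chain_of_p_cube D; split=> //.
  have E : antiper z N.+1 = antiper y N.+1.
    have := Slast z; have := Slast y.
    have := chain_le p q q0 qp x _ _ D C; have := chain_le p q q0 qp x _ _ C D.
    by move=> /(_ _ 0%N isT) h1 /(_ _ 0%N isT) h2; lia.
  apply: fin => j jN.
  have := chain_inj p q q0 qp x _ _ C D; rewrite E => /(_ erefl j jN); lia.
- by move=> h1 h2; case: (mixed z y).
- by move=> h1 h2; case: (mixed y z).
- move=> /chain_of_q_cube[C _] /chain_of_q_cube[D _]; split=> //.
  have E : antiper z N.+1 = antiper y N.+1.
    have := Tlast z; have := Tlast y.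
    have := chain_le p q q0 qp x _ _ D C; have := chain_le p q q0 qp x _ _ C D.
    by move=> /(_ _ 0%N isT) h1 /(_ _ 0%N isT) h2; lia.
  by apply: fin => j jN; apply: (chain_inj p q q0 qp x _ _ C D).
Qed.

Lemma std_side_gt0 e : 0 < std_side e.
Proof. by case: e; rewrite //= (lt_trans q0). Qed.

Lemma std_is_tiling : is_tiling std_tiling.
Proof.
split; first by move=> C /std_tilingP[e [z ->]]; apply: cube_closed.
split=> [x|C D /std_tilingP[e [z ->]] /std_tilingP[f [y ->]] neq].
  have [e [z xz]] := std_cover x.
  exists (cube (std_corner e z) (std_side e)); split.
    by apply/std_tilingP; exists e, z.
  by move=> i; have := xz i; lra.
set c := std_corner e z; set d := std_corner f y.
have [[i sep]|none] := pselect (exists i,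
  c i 0 + std_side e <= d i 0 \/ d i 0 + std_side f <= c i 0).
  exact: cube_sep_null sep.
exfalso; apply: neq.
have se := std_side_gt0 e; have sf := std_side_gt0 f.
(* The componentwise maximum of the lower corners lies in both half-open cubes. *)
pose x : 'cV[R]_N.+1 := \col_i Num.max (c i 0) (d i 0).
have lt1 i : c i 0 < d i 0 + std_side f.
  by rewrite ltNge; apply/negP => h; apply: none; exists i; right.
have lt2 i : d i 0 < c i 0 + std_side e.
  by rewrite ltNge; apply/negP => h; apply: none; exists i; left.
have [||ef zy] := std_disjoint x e z f y.
- by move=> i; rewrite [x i 0]mxE le_max lexx gt_max lt2 ltrDl se.
- by move=> i; rewrite [x i 0]mxE le_max lexx orbT gt_max lt1 ltrDl sf.
- by rewrite /c /d ef zy.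
Qed.

Lemma std_lattice_tiling : lattice_cube_tiling p q std_tiling.
Proof.
exists std_mx, (cube std_shift p), (cube 0 q); split; first exact: std_mx_unit.
split; first by exists std_shift.
split; first by exists 0.
by split=> //; exact: std_is_tiling.
Qed.

(** The corner of a p-cube moved by such a vector would still lie in the unmoved half-open p-cube.
    With [s = q] this excludes common facets of q-cubes. *)
Lemma std_vec_eq0 y i s : 0 <= s -> s < p ->
  std_vec y = s *: delta_mx i 0 -> s = 0.
Proof.
move=> s0 sp E.
have D k : (s *: delta_mx i 0 : 'cV[R]_N.+1) k 0 = s * (k == i)%:R.
  by rewrite !mxE eqxx andbT.
have [||_ y0] := std_disjoint (std_shift + s *: delta_mx i 0) true (fun=> 0) true y.
- move=> k; rewrite /std_corner std_vec0 addr0 [(_ + _ : 'cV_N.+1) k 0]mxE D /=.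
  by case: eqP => _; rewrite ?mulr1 ?mulr0; have := qp; have := q0; lra.
- by move=> k; rewrite /std_corner E lexx /= ltrDl; have := qp; have := q0; lra.
have := congr1 (fun v : 'cV[R]_N.+1 => v i 0) E.
by rewrite -y0 std_vec0 mxE D eqxx mulr1.
Qed.

(* The p-cube behind the q-cube at the origin in direction i has corner
   std_shift - (column 0 + ... + column i); moved forward by p it would contain
   the origin. *)
Lemma std_vec_neq_p y i : std_vec y <> p *: delta_mx i 0.
Proof.
move=> E; have [q0' qp'] := (q0, qp).
pose z (k : 'I_N.+1) : int := - ((k <= i)%N : nat)%:Z.
have D k : (p *: delta_mx i 0 : 'cV[R]_N.+1) k 0 = p * (k == i)%:R.
  by rewrite !mxE eqxx andbT.
have [||] // := std_disjoint 0 false (fun=> 0) true (fun k => z k + y k).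
  by move=> k; rewrite /std_corner std_vec0 addr0 /= mxE; lra.
move=> k; rewrite /std_corner std_vecD E /= 2!mxE [(_ + _ : 'cV_N.+1) k 0]mxE std_vecE D [(0 : 'cV_N.+1) k 0]mxE /antiper /z ltn_ord inord_val.
case: (ltnP k.+1 N.+1) => kN.
  rewrite inordK // -val_eqE /= (ltn_eqF (kN : (k < N)%N)) -val_eqE /=.
  by case: (ltngtP k i) => ki; rewrite ?mulrNz ?mulr0z ?oppr0 /=; lra.
have kE : k = ord_max.
  by apply/val_inj/eqP; rewrite /= eqn_leq -ltnS ltn_ord.
rewrite {}kE eqxx /= opprK -[_ == i]val_eqE /=.
have := ltn_ord i; rewrite ltnS leq_eqVlt => /orP[/eqP ->|iN].
  by rewrite leqnn eqxx; lra.
by rewrite leqNgt iN (gtn_eqF iN) /=; lra.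
Qed.

Lemma std_unilateral : (0 < N)%N -> unilateral std_tiling.
Proof.
move=> N0 s C D /std_tilingP[e [z ->]] /std_tilingP[f [y ->]] neq [a Ea] [b Eb].
have [_ es] := cube_inj _ _ _ _ (ltW (std_side_gt0 e)) Ea.
have [_ fs] := cube_inj _ _ _ _ (ltW (std_side_gt0 f)) Eb.
have ef : e = f.
  move: es fs; rewrite /std_side => <-; have := qp.
  by case: e f {Ea Eb neq} => -[] //= qp' E; move: qp'; rewrite E ltxx.
subst f; rewrite -fs in es.
have cneq : std_corner e z != std_corner e y.
  by apply/eqP => E; apply: neq; rewrite E.
move=> /(share_facet_shift _ _ _ N0 (std_side_gt0 e) cneq) [i].
have no u v : std_corner e u = std_corner e v + std_side e *: delta_mx i 0 -> False.
  rewrite /std_corner -addrA => /addrI E.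
  have {}E : std_vec (fun k => u k - v k) = std_side e *: delta_mx i 0.
    by rewrite std_vecB E addrAC subrr add0r.
  case: e E {Ea Eb neq es fs cneq} => /= E; first exact: std_vec_neq_p E.
  by have := std_vec_eq0 _ _ _ (ltW q0) qp E; have := q0; lra.
by case=> /no.
Qed.

End Standard.

(** * The p-cubes around one q-cube *)

(** A sign vector [s] names an orthant, and with it a vertex of the q-cube centered at the origin;
    [true] marks negative coordinates. *)
Definition sg {R : pzRingType} (e : bool) : R := if e then -1 else 1.

Definition flip {n} (s : 'I_n -> bool) (j : 'I_n) : 'I_n -> bool :=
  fun k => if k == j then ~~ s k else s k.

Lemma flipK {n} (s : 'I_n -> bool) j : flip (flip s j) j = s.
Proof. by apply/funext => k; rewrite /flip; case: eqP => // _; rewrite negbK. Qed.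

Lemma flipC {n} (s : 'I_n -> bool) i j : flip (flip s j) i = flip (flip s i) j.
Proof. by apply/funext => k; rewrite /flip; case: eqP; case: eqP. Qed.

Lemma flip_eq {n} (s : 'I_n -> bool) j : flip s j j = ~~ s j.
Proof. by rewrite /flip eqxx. Qed.

Lemma flip_neq {n} (s : 'I_n -> bool) j k : k != j -> flip s j k = s k.
Proof. by rewrite /flip => /negPf ->. Qed.

Lemma sgN {R : pzRingType} e : sg (~~ e) = - sg e :> R.
Proof. by case: e; rewrite /sg /= ?opprK. Qed.

(** [x], [x'] are the offsets of the cubes on the two sides in one direction, [y], [y'] those in the
    other. Flushness at the four corners of the square leaves only the two senses of rotation. *)
Lemma windmill_signs (R : realDomainType) (b x y x' y' : R) : 0 < b ->
  x = b \/ x = - b ->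
  x = - b \/ y = - b -> - x = - b \/ y' = - b ->
  x' = - b \/ - y = - b -> - x' = - b \/ - y' = - b -> x' = - x /\ y = - x.
Proof.
move=> b0 [->|->] [h1|h1] [h2|h2]; try (exfalso; lra).
  by move=> [h3|h3] _; split; lra.
all: by move=> [h3|h3] [h4|h4]; split; lra.
Qed.

(** For mixed signs the sum is [b] or [- b], and (p+q)/2 + b = p suffices. For equal signs one of
    the two implications moves [y] far enough. *)
Lemma sum3_bound (R : realFieldType) (p q y x1 x2 x3 : R) :
  let b := (p - q) / 2 in 0 < q -> q < p -> - b <= y < (p + q) / 2 ->
  x1 = b \/ x1 = - b -> x2 = b \/ x2 = - b -> x3 = b \/ x3 = - b ->
  (- x1 = b -> - x2 = b -> - x3 = b -> y = - b) ->
  (x1 = b -> x2 = b -> x3 = b -> b <= y) -> - p < y - (x1 + x2 + x3) < p.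
Proof.
move=> b q0 qp yb; rewrite {}/b in yb *.
move=> [->|->] [->|->] [->|->] low high; lra.
Qed.

Section Local.
(** [Lam] is the lattice and [G] the set of centers of p-cubes, seen from the center of a q-cube. In
    [cover] the open sides of the half-open cubes may be chosen by [s]. *)
Context {R : realFieldType} {n : nat} (p q : R) (Lam G : set 'cV[R]_n).
Hypotheses (q0 : 0 < q) (qp : q < p).
Hypothesis LamB : forall x y, Lam x -> Lam y -> Lam (x - y).
Hypothesis GB : forall g h, G g -> G h -> Lam (g - h).
Hypothesis Lam_sep : forall x, Lam x -> (forall i, `|x i 0| < p) -> x = 0.
Hypothesis G_sep : forall g, G g -> ~ (forall i, `|g i 0| < (p + q) / 2).
Hypothesis cover : forall (v : 'cV[R]_n) (s : 'I_n -> bool),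
  (exists2 x, Lam x & forall j, - (q / 2) <= sg (s j) * (v j 0 - x j 0) < q / 2) \/
  (exists2 g, G g & forall j, - (p / 2) <= sg (s j) * (v j 0 - g j 0) < p / 2).

Local Notation a := ((p + q) / 2).
Local Notation b := ((p - q) / 2).

Lemma G_inj s g h : G g -> G h ->
  (forall i, - p < sg (s i) * g i 0 - sg (s i) * h i 0 < p) -> g = h.
Proof.
move=> Gg Gh H; apply/eqP; rewrite -subr_eq0; apply/eqP.
apply: Lam_sep; first exact: GB.
move=> i; rewrite ltr_norml !mxE; have := H i; rewrite /sg.
by case: (s i) => /andP[h1 h2]; apply/andP; split; lra.
Qed.

(** Consider points near the vertex [s] of the q-cube, just outside in the directions of [P] and
    just inside in the others. The q-cube misses them as [P] is nonempty, and no other q-cube comes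
    near, so a p-cube covers them. *)
Lemma orthant_G s (P : pred 'I_n) i0 : P i0 ->
  exists2 g, G g & forall j, if P j then - b < sg (s j) * g j 0 <= a
                             else - b <= sg (s j) * g j 0 < a.
Proof.
move=> Pi0; have [q0' qp'] := (q0, qp).
pose v : 'cV[R]_n := \col_j (sg (s j) * (q / 2)).
have [[x Lx xP]|[g Gg gP]] := cover v (fun j => if P j then s j else ~~ s j).
  suff x0 : x = 0.
    by have := xP i0; rewrite Pi0 x0 !mxE /sg; case: (s i0); lra.
  apply: Lam_sep => // j; have := xP j.
  by rewrite mxE ltr_norml /sg; case: (P j) (s j) => -[] /=; lra.
exists g => // j; have := gP j.
by rewrite mxE /sg; case: (P j) (s j) => -[] /= /andP[h1 h2]; apply/andP; split; lra.
Qed.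

(** [g] is the center of the p-cube resting on the facet in direction [i] and covering that facet
    near the vertex [s]. *)
Definition nbr (s : 'I_n -> bool) i g : Prop :=
  [/\ G g, sg (s i) * g i 0 = a & forall j, j != i -> - b <= sg (s j) * g j 0 < a].

(** Take [P] to be the singleton of [i]: an i-th entry below [a] would make the p-cube overlap the
    q-cube. *)
Lemma nbr_exists s i : exists g, nbr s i g.
Proof.
have [q0' qp'] := (q0, qp).
have [g Gg gP] := orthant_G s (pred1 i) i (eqxx i).
have gi := gP i; rewrite /= eqxx in gi.
have gj j : j != i -> - b <= sg (s j) * g j 0 < a.
  by move=> ji; have := gP j; rewrite /= (negPf ji).
exists g; split=> //; apply/eqP; apply: contra_notT (G_sep g Gg) => ga j.
have [->|ji] := eqVneq j i.
  by move: gi ga; rewrite ltr_norml /sg neq_lt; case: (s i) => /andP[h1 h2] /orP[]; lra.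
by have := gj j ji; rewrite ltr_norml /sg; case: (s j); lra.
Qed.

Lemma nbr_inj s i g h : nbr s i g -> nbr s i h -> g = h.
Proof.
have [q0' qp'] := (q0, qp).
move=> [Gg gi gj] [Gh hi hj]; apply: (G_inj s) => // j.
have [->|ji] := eqVneq j i; first by rewrite gi hi; lra.
have := gj j ji; have := hj j ji; lra.
Qed.

(** An offset [- b] means ending flush with the q-cube at the vertex [s]. If neither p-cube did,
    both would reach beyond it and overlap. *)
Lemma nbr_pair s i j g h : i != j -> nbr s i g -> nbr s j h ->
  sg (s j) * g j 0 = - b \/ sg (s i) * h i 0 = - b.
Proof.
have [q0' qp'] := (q0, qp).
move=> ij [Gg gi gj] [Gh hj hi].
have [->|/eqP gb] := eqVneq (sg (s j) * g j 0) (- b); first by left.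
have [->|/eqP hb] := eqVneq (sg (s i) * h i 0) (- b); first by right.
have gj' := gj j ltac:(by rewrite eq_sym); have hi' := hi i ij.
suff E : g = h by move: gi hi'; rewrite E; lra.
apply: (G_inj s) => // k.
have [->|ki] := eqVneq k i; first by rewrite gi; move: hb hi'; lra.
have [->|kj] := eqVneq k j; first by rewrite hj; move: gb gj'; lra.
have := gj k ki; have := hi k kj; lra.
Qed.

(** With offset [b] or [- b] the p-cube spans the q-cube in direction [j], so it is a neighbour at
    both ends. *)
Lemma nbr_flip s i j g : j != i -> nbr s i g ->
  sg (s j) * g j 0 = - b \/ sg (s j) * g j 0 = b -> nbr (flip s j) i g.
Proof.
have [q0' qp'] := (q0, qp).
move=> ji [Gg gi gj] gb; split => //; first by rewrite flip_neq // eq_sym.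
move=> k ki; have [->|kj] := eqVneq k j.
  by rewrite flip_eq sgN mulNr; case: gb => ->; lra.
by rewrite flip_neq ?gj.
Qed.

(* In the plane of the coordinates i and j, the four p-cubes at the sides of a
   q-cube form a windmill: once one of them ends flush with the q-cube, going
   around the q-cube forces the others. *)
Lemma windmill s i j g : j != i -> nbr s i g ->
  sg (s j) * g j 0 = - b \/ sg (s j) * g j 0 = b.
Proof.
have [q0' qp'] := (q0, qp).
move=> ji Ng; have ij : i != j by rewrite eq_sym.
have bN : b <> - b by lra.
have [h Nh] := nbr_exists s j.
have [|hi] := nbr_pair s i j g h ij Ng Nh; first by left.
have Nh1 := nbr_flip s j i h ij Nh (or_introl hi).
have [g1 Ng1] := nbr_exists (flip s i) i.
have [g1j|] := nbr_pair _ i j g1 h ij Ng1 Nh1; last first.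
  by rewrite flip_eq sgN mulNr hi; lra.
have Ng2 := nbr_flip _ i j g1 ji Ng1 (or_introl g1j).
have [h2 Nh2] := nbr_exists (flip (flip s i) j) j.
have [|h2i] := nbr_pair _ i j g1 h2 ij Ng2 Nh2.
  by rewrite flip_eq sgN mulNr g1j; lra.
have Nh3 := nbr_flip _ j i h2 ij Nh2 (or_introl h2i).
rewrite flipC flipK in Nh3.
have [g3 Ng3] := nbr_exists (flip s j) i.
have [g3j|] := nbr_pair _ i j g3 h2 ij Ng3 Nh3; last first.
  move: h2i; rewrite flip_neq // flip_eq sgN mulNr => h2i.
  by rewrite flip_neq //; lra.
have Ng4 := nbr_flip _ i j g3 ji Ng3 (or_introl g3j); rewrite flipK in Ng4.
(* The tour is closed: [g3] is a neighbour at the starting vertex too, hence equals [g]. *)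
rewrite (nbr_inj _ _ _ _ Ng Ng4); right.
by move: g3j; rewrite flip_eq sgN mulNr; lra.
Qed.

Lemma frame_exists : exists u : 'I_n -> 'cV[R]_n, forall i,
  [/\ G (u i), G (- u i), u i i 0 = a &
      forall j, j != i -> (u i j 0 = b \/ u i j 0 = - b) /\ u j i 0 = - u i j 0].
Proof.
have [q0' qp'] := (q0, qp).
have [[e i]|nb nbP] := @choice (bool * 'I_n) _
    (fun ei g => nbr (fun=> ei.1) ei.2 g); first exact: nbr_exists.
have nbG e i : G (nb (e, i)) by case: (nbP (e, i)).
have nbi e i : sg e * nb (e, i) i 0 = a by case: (nbP (e, i)).
have nbj e i j : j != i -> nb (e, i) j 0 = b \/ nb (e, i) j 0 = - b.
  move=> ji; have := windmill _ _ _ _ ji (nbP (e, i)); rewrite /sg /=.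
  by case: e => -[] h; [left|right|right|left]; lra.
(* One p-cube serves a whole facet: its offsets are all [b] or [- b], so it is a neighbour at every
   vertex there. *)
have nbs e i (s : 'I_n -> bool) : s i = e -> nbr s i (nb (e, i)).
  move=> si; split; rewrite ?si // => j ji.
  by have := nbj e i j ji; rewrite /sg; case: (s j) => -[] ->; lra.
have pair e f i j : i != j ->
    sg f * nb (e, i) j 0 = - b \/ sg e * nb (f, j) i 0 = - b.
  move=> ij; pose s k := if k == i then e else f.
  have si : s i = e by rewrite /s eqxx.
  have sj : s j = f by rewrite /s eq_sym (negPf ij).
  have := nbr_pair s i j _ _ ij (nbs e i s si) (nbs f j s sj).
  by rewrite si sj.
have key i j : j != i -> nb (true, i) j 0 = - nb (false, i) j 0 /\
    nb (false, j) i 0 = - nb (false, i) j 0.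
  move=> ji; have ij : i != j by rewrite eq_sym.
  apply: (@windmill_signs _ b _ _ _ (nb (true, j) i 0)); first lra.
  - exact: nbj.
  - by have := pair false false i j ij; rewrite /sg !mul1r.
  - by have := pair true false j i ji; rewrite /sg mul1r mulN1r => -[]; [right|left].
  - by have := pair true false i j ij; rewrite /sg mul1r mulN1r.
  - by have := pair true true i j ij; rewrite /sg !mulN1r.
exists (fun i => nb (false, i)) => i; split => //.
- have -> : - nb (false, i) = nb (true, i); last by [].
  apply/colP => j; rewrite mxE; have [->|ji] := eqVneq j i.
    by have := nbi true i; have := nbi false i; rewrite /sg; lra.
  by rewrite (key i j ji).1.
- by have := nbi false i; rewrite /sg mul1r.
- by move=> j ji; split; [exact: nbj|exact: (key i j ji).2].
Qed.

(** The two cubes overlap in every direction but [r], so there [g] must lie beyond [w], at least at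
    [- b + p = a]. *)
Lemma flush_neighbour s g w m r : G g -> G w ->
  sg (s m) * w m 0 = a -> - b < sg (s m) * g m 0 <= a ->
  sg (s r) * w r 0 = - b -> - b < sg (s r) * g r 0 <= a ->
  (forall t, t != m -> t != r -> - p < sg (s t) * g t 0 - sg (s t) * w t 0 < p) ->
  sg (s r) * g r 0 = a.
Proof.
have [q0' qp'] := (q0, qp).
move=> Gg Gw wm gm wr gr H; apply/eqP; apply: contraT => ga.
have lta : sg (s r) * g r 0 < a by rewrite lt_neqAle ga; case/andP: gr.
suff E : g = w by move: (gr); rewrite E wr; lra.
apply: (G_inj s) => // t.
have [->|tr] := eqVneq t r; first by rewrite wr; lra.
have [->|tm] := eqVneq t m; first by rewrite wm; lra.
exact: H.
Qed.

(** [g] covers the points just outside in the directions i, j, k; each cube of the cycle pushes it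
    to [a] in one of them. If [t] dominates the cycle, [g] is near [w t] in all directions but [t],
    so their t-th entries differ by at least p; if the cycle dominates [t], the same holds with
    [- w t]. *)
Lemma cycle_filler s (w : 'I_n -> 'cV[R]_n) i j k :
  let W i j := sg (s j) * w i j 0 in
  (forall i, [/\ G (w i), G (- w i), W i i = a &
     forall j, j != i -> (W i j = b \/ W i j = - b) /\ W j i = - W i j]) ->
  W i j = b -> W j k = b -> W k i = b ->
  exists2 g, G g & let y m := sg (s m) * g m 0 in
    [/\ y i = a, y j = a, y k = a &
     forall t, t != i -> t != j -> t != k -> [/\ - b <= y t < a,
      W t i = b -> W t j = b -> W t k = b -> y t = - b &
      W i t = b -> W j t = b -> W k t = b -> b <= y t]].
Proof.
have [q0' qp'] := (q0, qp).
move=> W wP ij jk ki.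
have Wii m : W m m = a by case: (wP m).
have Wpm m r : r != m -> W m r = b \/ W m r = - b by case: (wP m) => _ _ _ /(_ r) H /H[].
have Wskew m r : r != m -> W r m = - W m r by case: (wP m) => _ _ _ /(_ r) H /H[].
have ab : a <> b by lra.
have neq m r : W m r = b -> r != m.
  by move=> E; apply/eqP => rm; apply: ab; rewrite -E rm Wii.
have nij := neq _ _ ij; have njk := neq _ _ jk; have nki := neq _ _ ki.
have ji := Wskew _ _ nij; have kj := Wskew _ _ njk; have ik := Wskew _ _ nki.
rewrite ij in ji; rewrite jk in kj; rewrite ki in ik.
pose P := pred3 i j k.
have Pi : P i by rewrite /= eqxx.
have Pj : P j by rewrite /= eqxx orbT.
have Pk : P k by rewrite /= eqxx !orbT.
have [g Gg gP] := orthant_G s P i Pi.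
pose y m := sg (s m) * g m 0.
have yP m : P m -> - b < y m <= a by move=> Pm; have := gP m; rewrite Pm.
have yPN m : m != i -> m != j -> m != k -> - b <= y m < a.
  by move=> /negPf mi /negPf mj /negPf mk; have := gP m; rewrite /P /= mi mj mk.
have [Gwi _ _ _] := wP i; have [Gwj _ _ _] := wP j; have [Gwk _ _ _] := wP k.
have near1 x z : - b <= x < a -> z = b \/ z = - b -> - p < x - z < p.
  move=> h1 [] ->; lra.
have near2 x z : - b < x <= a -> z = b -> - p < x - z < p.
  move=> h1 ->; lra.
have yk : y k = a.
  apply: (flush_neighbour s g (w i) i k Gg Gwi (Wii i) (yP i Pi) ik (yP k Pk)) => t ti tk.
  have [->|tj] := eqVneq t j; first exact: near2 _ _ (yP j Pj) ij.
  by apply: near1; [exact: yPN|exact: Wpm].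
have yi : y i = a.
  apply: (flush_neighbour s g (w j) j i Gg Gwj (Wii j) (yP j Pj) ji (yP i Pi)) => t tj ti.
  have [->|tk] := eqVneq t k; first exact: near2 _ _ (yP k Pk) jk.
  by apply: near1; [exact: yPN|exact: Wpm].
have yj : y j = a.
  apply: (flush_neighbour s g (w k) k j Gg Gwk (Wii k) (yP k Pk) kj (yP j Pj)) => t tk tj.
  have [->|ti] := eqVneq t i; first exact: near2 _ _ (yP i Pi) ki.
  by apply: near1; [exact: yPN|exact: Wpm].
exists g => //; split => // t ti tj tk.
have yt := yPN t ti tj tk.
have far (h : 'cV[R]_n) : G h -> sg (s i) * h i 0 = b -> sg (s j) * h j 0 = b ->
    sg (s k) * h k 0 = b ->
    (forall r, r != t -> sg (s r) * h r 0 = b \/ sg (s r) * h r 0 = - b) ->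
    - p < y t - sg (s t) * h t 0 < p -> False.
  move=> Gh hi hj hk hr ht; apply: ab; rewrite -yi -hi /y; congr (_ * _).
  suff -> : g = h by [].
  apply: (G_inj s) => // r; rewrite -/(y r).
  have [->|rt] := eqVneq r t; first by [].
  have [->|ri] := eqVneq r i; first by rewrite yi hi; lra.
  have [->|rj] := eqVneq r j; first by rewrite yj hj; lra.
  have [->|rk] := eqVneq r k; first by rewrite yk hk; lra.
  by apply: near1; [exact: yPN|exact: hr].
split => // [Wti Wtj Wtk|Wit Wjt Wkt].
  apply/eqP; apply: contraT => yb; exfalso.
  have [Gw _ _ _] := wP t; apply: (far (w t)) => // [r|]; first exact: Wpm.
  have ltb : - b < y t by rewrite lt_neqAle eq_sym yb; case/andP: yt.
  by rewrite -/(W t t) Wii; lra.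
rewrite -/(y t) leNgt; apply/negP => ytb.
have [_ GNw _ _] := wP t; apply: (far (- w t)) => // [|||r|].
- by rewrite mxE mulrN -/(W t i) -Wskew // eq_sym.
- by rewrite mxE mulrN -/(W t j) -Wskew // eq_sym.
- by rewrite mxE mulrN -/(W t k) -Wskew // eq_sym.
- move=> rt; rewrite mxE mulrN -/(W t r).
  by case: (Wpm t r rt) => ->; [right|left; rewrite opprK].
- by rewrite mxE mulrN -/(W t t) Wii; lra.
Qed.

(* A 3-cycle i, j, k leaves an orthant at the vertex [s] of the q-cube that only
   a further p-cube, with center g, can fill.  If l dominates the cycle, the
   lattice vector g - w i - w j - w k is shorter than p but has l-th entry 2b. *)
Lemma no_dominated_cycle s (w : 'I_n -> 'cV[R]_n) i j k l :
  let W i j := sg (s j) * w i j 0 in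
  (forall i, [/\ G (w i), G (- w i), W i i = a &
     forall j, j != i -> (W i j = b \/ W i j = - b) /\ W j i = - W i j]) ->
  W i j = b -> W j k = b -> W k i = b -> W l i = b -> W l j = b -> W l k = b -> False.
Proof.
have [q0' qp'] := (q0, qp).
move=> W wP ij jk ki li lj lk.
have [g Gg [yi yj yk yt]] := cycle_filler s w i j k wP ij jk ki.
have Wii m : W m m = a by case: (wP m).
have Wpm m r : r != m -> W m r = b \/ W m r = - b by case: (wP m) => _ _ _ /(_ r) H /H[].
have Wskew m r : r != m -> W r m = - W m r by case: (wP m) => _ _ _ /(_ r) H /H[].
have ab : a <> b by lra.
have neq m r : W m r = b -> r != m.
  by move=> E; apply/eqP => rm; apply: ab; rewrite -E rm Wii.
have ji := Wskew _ _ (neq _ _ ij); have kj := Wskew _ _ (neq _ _ jk).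
have ik := Wskew _ _ (neq _ _ ki).
(* As [- w k] is a center too, both brackets are lattice vectors. *)
pose d := (g - w i) - (w j - - w k).
have dE t : sg (s t) * d t 0 = sg (s t) * g t 0 - (W i t + W j t + W k t).
  by rewrite /d /W !mxE; ring.
have Ld : Lam d by apply: LamB; apply: GB => //; case: (wP i) (wP j) (wP k) => ? ? ? ? [? ? ? ?] [].
have d0 : d = 0.
  apply: Lam_sep => // t.
  suff : - p < sg (s t) * d t 0 < p.
    by rewrite ltr_norml /sg; case: (s t) => /andP[h1 h2]; apply/andP; split; lra.
  rewrite dE.
  have [->|ti] := eqVneq t i.
    by rewrite yi Wii ji ij ki; lra.
  have [->|tj] := eqVneq t j.
    by rewrite yj Wii kj jk ij; lra.
  have [->|tk] := eqVneq t k.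
    by rewrite yk Wii ik jk ki; lra.
  have [bnd low high] := yt t ti tj tk.
  have Wti := Wskew _ _ ti; have Wtj := Wskew _ _ tj; have Wtk := Wskew _ _ tk.
  move: low; rewrite -/(W t i) -/(W t j) -/(W t k) Wti Wtj Wtk => low.
  by apply: sum3_bound q0 qp bnd _ _ _ low high; exact: Wpm.
have nli := neq _ _ li; have nlj := neq _ _ lj; have nlk := neq _ _ lk.
have [_ low _] := yt l ltac:(by rewrite eq_sym) ltac:(by rewrite eq_sym) ltac:(by rewrite eq_sym).
have := dE l; rewrite d0 mxE mulr0 low //.
rewrite (Wskew _ _ nli) (Wskew _ _ nlj) (Wskew _ _ nlk) ?li ?lj ?lk.
by lra.
Qed.

End Local.

(** * Sorting the tournament *)

Lemma sgK {R : pzRingType} (e : bool) (x : R) : sg e * (sg e * x) = x.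
Proof. by case: e; rewrite /sg ?mul1r // !mulN1r opprK. Qed.

Definition signed_perm {R : pzRingType} {n} (s : 'I_n -> bool) (r : {perm 'I_n})
  (x : 'cV[R]_n) : 'cV[R]_n := \col_j (sg (s j) * x (r j) 0).

(** The center of the p-cube on the facet in direction [k] of the standard tiling, seen from the
    center of the q-cube. *)
Definition frame {R : fieldType} {n} (p q : R) (k : 'I_n) : 'cV[R]_n :=
  \col_j (if j == k then (p + q) / 2
          else if (k < j)%N then - ((p - q) / 2) else (p - q) / 2).

(** The rank counts the dominated elements: transitivity makes it monotone, totality injective. *)
Lemma tournament_rank {n} (dom : rel 'I_n) :
  irreflexive dom -> transitive dom -> (forall i j, i != j -> dom i j || dom j i) ->
  exists r : {perm 'I_n}, forall i j, dom i j -> (r j < r i)%N.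
Proof.
move=> irr tr tot; have cardP i : (#|[set j | dom i j]%SET| < n)%N.
  rewrite -[ltnRHS]card_ord; apply: proper_card; apply/properP.
  by split; [apply/fintype.subsetP|exists i; rewrite ?inE ?irr].
pose f i := Ordinal (cardP i).
have fP i j : dom i j -> (f j < f i)%N.
  move=> ij; apply: proper_card; apply/properP; split.
    by apply/fintype.subsetP => k; rewrite !inE; apply: tr.
  by exists j; rewrite inE ?irr.
have inj_f : injective f.
  move=> i j E; apply/eqP; apply: contraT => /tot /orP[] /fP; by rewrite E ltnn.
by exists (perm inj_f) => i j; rewrite !permE; apply: fP.
Qed.

Lemma standard_frame {R : realFieldType} {N : nat} (p q : R)
    (Lam G : set 'cV[R]_N.+1) :
  0 < q -> q < p ->
  (forall x y, Lam x -> Lam y -> Lam (x - y)) ->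
  (forall g h, G g -> G h -> Lam (g - h)) ->
  (forall x, Lam x -> (forall i, `|x i 0| < p) -> x = 0) ->
  (forall g, G g -> ~ (forall i, `|g i 0| < (p + q) / 2)) ->
  (forall (v : 'cV[R]_N.+1) (s : 'I_N.+1 -> bool),
    (exists2 x, Lam x & forall j, - (q / 2) <= sg (s j) * (v j 0 - x j 0) < q / 2) \/
    (exists2 g, G g & forall j, - (p / 2) <= sg (s j) * (v j 0 - g j 0) < p / 2)) ->
  exists s (r : {perm 'I_N.+1}), forall k,
    G (signed_perm s r (frame p q k)) /\ G (- signed_perm s r (frame p q k)).
Proof.
move=> q0 qp LamB GB Lam_sep G_sep cover.
have [u uP] := frame_exists p q Lam G q0 qp GB Lam_sep G_sep cover.
set a := (p + q) / 2 in uP; set b := (p - q) / 2 in uP.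
have ab : a <> b by rewrite /a /b; lra.
have b0 : b <> - b by rewrite /b; lra.
(* The vertex at which coordinate 0 dominates: these signs make every offset of [w ord0] equal to
   [b]. *)
pose s j := u ord0 j 0 == - b.
pose w i : 'cV[R]_N.+1 := sg (s i) *: u i.
pose W i j := sg (s j) * w i j 0.
have Wii i : W i i = a by rewrite /W mxE sgK; case: (uP i).
have Wij i j : j != i -> (W i j = b \/ W i j = - b) /\ W j i = - W i j.
  move=> ji; case: (uP i) => _ _ _ /(_ j ji); rewrite /W !mxE => -[h ->].
  split; last by rewrite mulrCA !mulrN.
  by rewrite /sg; case: (s i) (s j) h => -[] [] ->;
    rewrite ?mul1r ?mulN1r ?mul1r ?opprK; auto.
have wP i : [/\ G (w i), G (- w i), W i i = a &
     forall j, j != i -> (W i j = b \/ W i j = - b) /\ W j i = - W i j].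
  case: (uP i) => G1 G2 _ _; split => //; last by move=> j; apply: Wij.
    by rewrite /w /sg; case: (s i); rewrite ?scaleN1r ?scale1r.
  by rewrite /w /sg; case: (s i); rewrite ?scaleN1r ?scale1r ?opprK.
have W0 j : j != ord0 -> W ord0 j = b.
  move=> j0; rewrite /W mxE.
  have -> : s ord0 = false by apply/negbTE/eqP; case: (uP ord0) => _ _ -> _; rewrite /a /b; lra.
  rewrite {2}/sg mul1r /sg /s; case: (uP ord0) => _ _ _ /(_ j j0) [[]-> _].
    by rewrite (negPf (introN eqP b0)) mul1r.
  by rewrite eqxx mulN1r opprK.
pose dom i j := W i j == b.
have irr : irreflexive dom by move=> i; apply/negbTE/eqP; rewrite Wii.
have neq i j : dom i j -> j != i.
  by move=> ij; apply/eqP => E; move: ij; rewrite E irr.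
have asym i j : dom i j -> ~~ dom j i.
  move=> ij; rewrite /dom (Wij _ _ (neq _ _ ij)).2 (eqP ij).
  by apply/eqP => E; apply: b0.
have tot i j : i != j -> dom i j || dom j i.
  move=> ij; rewrite /dom; case: (Wij _ _ ij) => -[->|->] ->; rewrite ?eqxx ?orbT //.
  by rewrite opprK eqxx.
have tr : transitive dom.
  (* Failure of transitivity gives a 3-cycle. Its members are dominated, so none is [ord0], which
     therefore dominates all three. *)
  move=> j i k ij jk; apply: contraT => ik.
  have ki : dom k i.
    have nik : i != k by apply/eqP => E; move: (asym _ _ ij); rewrite E jk.
    by case/orP: (tot _ _ nik) => // H; rewrite H in ik.
  have dom0 x y : dom x y -> y != ord0.
    move=> xy; apply/eqP => y0; move: (asym _ _ xy).
    by rewrite y0 /dom W0 ?eqxx // -y0 eq_sym; apply: neq.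
  exfalso; apply: (no_dominated_cycle p q Lam G q0 qp LamB GB Lam_sep cover s w i j k ord0 wP);
    [exact/eqP|exact/eqP|exact/eqP|apply: W0..].
  - exact: dom0 ki.
  - exact: dom0 ij.
  - exact: dom0 jk.
have [r rP] := tournament_rank _ irr tr tot.
exists s, r => k.
suff -> : signed_perm s r (frame p q k) = w ((r^-1)%g k) by case: (wP ((r^-1)%g k)).
set i := (r^-1)%g k; have ki : k = r i by rewrite /i permKV.
apply/colP => j; rewrite -[RHS](sgK (s j)) -/(W i j) 2!mxE -/a -/b; congr (_ * _).
rewrite ki (inj_eq perm_inj).
have [->|ji] := eqVneq j i; first by rewrite Wii.
case: ltnP => rij.
  have ij : dom j i.
    by case/orP: (tot _ _ ji) => // /rP; rewrite ltnNge (ltnW rij).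
  by rewrite (Wij _ _ (neq _ _ ij)).2 (eqP ij).
case/orP: (tot _ _ ji) => [/rP|/eqP->//].
by rewrite ltnNge rij.
Qed.

(** * Lattices and half-open coverings *)

Section Lattice.
Context {R : realType} {n : nat} (B : 'M[R]_n).

Lemma lattice0 : lattice B 0.
Proof.
exists (fun=> 0) => //.
by rewrite (_ : \col_i _ = 0) ?mulmx0 //; apply/colP => i; rewrite !mxE.
Qed.

Lemma latticeB x y : lattice B x -> lattice B y -> lattice B (x - y).
Proof.
move=> [z _ <-] [w _ <-]; exists (fun i => z i - w i) => //.
by rewrite -mulmxBr; congr (_ *m _); apply/colP => i; rewrite !mxE intrB.
Qed.

Lemma latticeD x y : lattice B x -> lattice B y -> lattice B (x + y).
Proof.
move=> Lx Ly; rewrite -[y]opprK; apply: latticeB => //.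
by rewrite -[- y]add0r; apply: latticeB => //; exact: lattice0.
Qed.

(** [invmx B] bounds the integer coordinates of a bounded lattice vector by [K]; the finite type
    lists the coordinates from -K to K, shifted by K. *)
Lemma lattice_locally_finite (M : R) : B \in unitmx ->
  exists (T : finType) (f : T -> 'cV[R]_n), forall x, lattice B x ->
    (forall j, `|x j 0| <= M) -> exists t, x = f t.
Proof.
move=> Bu.
pose S := \sum_i \sum_j `|invmx B i j| * M.
pose K := (Num.truncn S).+1.
exists {ffun 'I_n -> 'I_(K + K).+1}.
exists (fun t : {ffun 'I_n -> 'I_(K + K).+1} => B *m \col_i ((nat_of_ord (t i))%:Z - K%:Z)%:~R).
move=> x [z _ <-] xM; set v : 'cV[R]_n := \col_i _ in xM *.
have M0 (i : 'I_n) : 0 <= M := le_trans (normr_ge0 _) (xM i).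
have zK i : `|z i| <= K%:Z.
  rewrite -(ler_int R) intr_norm.
  have -> : (z i)%:~R = \sum_j invmx B i j * (B *m v) j 0.
    by have := mulKmx Bu v => /(congr1 (fun u : 'cV[R]_n => u i 0)); rewrite !mxE => <-.
  apply: le_trans (ler_norm_sum _ _ _) _.
  apply: (@le_trans _ _ S); last by apply/ltW/truncnS_gt.
  have H : 0 <= \sum_(i0 < n | i0 != i) \sum_j `|invmx B i0 j| * M.
    by apply: sumr_ge0 => i' _; apply: sumr_ge0 => j _; rewrite mulr_ge0 ?(M0 i).
  rewrite [S](bigD1 i) //= -[leLHS]addr0; apply: lerD H.
  by apply: ler_sum => j _; rewrite normrM ler_wpM2l.
exists [ffun i => inord (absz (z i + K%:Z))].
congr (_ *m _); apply/colP => i; rewrite !mxE ffunE inordK.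
  by congr (_%:~R); have := zK i; lia.
by have := zK i; lia.
Qed.

End Lattice.

Lemma common_threshold {R : realFieldType} (T : finType) (P : T -> R -> Prop) :
  (forall t, exists2 d, 0 < d & forall e, 0 < e -> e < d -> P t e) ->
  exists2 d, 0 < d & forall t e, 0 < e -> e < d -> P t e.
Proof.
move=> H; suff [d d0 dP] : exists2 d, 0 < d &
    forall t, t \in enum T -> forall e, 0 < e -> e < d -> P t e.
  by exists d => // t e; apply: dP; rewrite mem_enum.
elim: (enum T) => [|t r [d d0 dP]]; first by exists 1.
have [d' d'0 d'P] := H t.
exists (Num.min d d'); first by rewrite lt_min d0 d'0.
move=> u; rewrite inE => /orP[/eqP ->|ur] e e0; rewrite lt_min => /andP[ed ed'].
  exact: d'P.
exact: dP.
Qed.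

(** Push [w] by a small [e] into the orthant [s]. Only finitely many tiles come near, so a common
    [e] works for all: a tile not containing [w] in the half-open sense misses the pushed point as
    well. *)
Lemma orthant_cover {R : realType} {n : nat} (B : 'M[R]_n) (c : bool -> 'cV[R]_n)
    (side : bool -> R) : B \in unitmx -> (forall k, 0 < side k) ->
  (forall x, exists k, exists2 u, lattice B u & cube (c k + u) (side k) x) ->
  forall (w : 'cV[R]_n) (s : 'I_n -> bool), exists k, exists2 u, lattice B u &
    forall j, - (side k / 2) <= sg (s j) * (w j 0 - (c k + u) j 0 - side k / 2) < side k / 2.
Proof.
move=> Bu side0 cov w s.
pose pt e : 'cV[R]_n := \col_j (w j 0 + sg (s j) * e).
pose M := \sum_j (`|w j 0| + 1 + `|c true j 0| + `|c false j 0| + side true + side false).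
have [T [f fP]] := lattice_locally_finite B M Bu.
apply: contrapT => none.
have [|d d0 dP] := @common_threshold _ (bool * T)%type
   (fun kt e => lattice B (f kt.2) -> ~ cube (c kt.1 + f kt.2) (side kt.1) (pt e)).
  move=> [k t] /=; have [Lt|nLt] := pselect (lattice B (f t)); last by exists 1.
  have /existsNP[j /negP] : ~ forall j, - (side k / 2) <=
      sg (s j) * (w j 0 - (c k + f t) j 0 - side k / 2) < side k / 2.
    by move=> H; apply: none; exists k, (f t).
  rewrite negb_and -ltNge -leNgt => /orP[] h.
    exists (- (side k / 2) - sg (s j) * (w j 0 - (c k + f t) j 0 - side k / 2)).
      by rewrite subr_gt0.
    move=> e e0 ed _ /(_ j); rewrite [pt e j 0]mxE.
    by move: h ed; rewrite /sg; case: (s j); lra.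
  exists 1 => // e e0 _ _ /(_ j); rewrite [pt e j 0]mxE.
  by move: h; rewrite /sg; case: (s j); lra.
pose e := Num.min (d / 2) 1.
have e0 : 0 < e by rewrite /e lt_min ltr01 andbT; lra.
have e1 : e <= 1 by rewrite /e ge_min lexx orbT.
have ed : e < d by rewrite /e gt_min; apply/orP; left; lra.
have [k [u Lu xu]] := cov (pt e).
have [j|t ut] := fP u Lu.
  apply: (@le_trans _ _ (`|w j 0| + 1 + `|c true j 0| + `|c false j 0| + side true + side false)).
    have := xu j; rewrite [pt e j 0]mxE [(_ + _ : 'cV_n) j 0]mxE.
    have := side0 k; have := side0 (~~ k).
    have := ler_norm (w j 0); have := ler_norm (- w j 0).
    have := ler_norm (c k j 0); have := ler_norm (- c k j 0).
    have := normr_ge0 (c (~~ k) j 0); rewrite !normrN ler_norml /sg.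
    by case: k {Lu xu}; case: (s j) => /= *; apply/andP; split; lra.
  rewrite /M (bigD1 j) //= lerDl sumr_ge0 // => i _.
  by rewrite !addr_ge0 // ltW.
by have := dP (k, t) e e0 ed; rewrite /= -ut; apply.
Qed.

(** * Moving the standard tiling onto a given one *)

Section CubeTiling.
Context {R : realType} {N : nat} (p q : R).
Hypotheses (q0 : 0 < q) (qp : q < p).
Variables (B : 'M[R]_N.+1) (a b : 'cV[R]_N.+1).
Hypothesis B_unit : B \in unitmx.

Definition cube_tiling : set (set 'cV[R]_N.+1) :=
  [set C | exists2 v, lattice B v & C = cube (a + v) p \/ C = cube (b + v) q].

Hypothesis tiling : is_tiling cube_tiling.

Lemma tile_p v : lattice B v -> cube_tiling (cube (a + v) p).
Proof. by move=> Lv; exists v => //; left. Qed.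

Lemma tile_q v : lattice B v -> cube_tiling (cube (b + v) q).
Proof. by move=> Lv; exists v => //; right. Qed.

Lemma tile_sep c s d t : 0 < s -> 0 < t ->
  cube_tiling (cube c s) -> cube_tiling (cube d t) -> cube c s <> cube d t ->
  exists i, c i 0 + s <= d i 0 \/ d i 0 + t <= c i 0.
Proof.
move=> s0 t0 Fc Fd cd; apply: cube_null_sep => //.
exact: tiling.2.2.
Qed.

(* Centers of the p-cubes relative to the center of one q-cube. *)
Definition centers : set 'cV[R]_N.+1 :=
  [set g | exists2 v, lattice B v & g = a + v + const_mx (p / 2) - (b + const_mx (q / 2))].

Lemma tiling_frame : exists s (r : {perm 'I_N.+1}), forall k,
  centers (signed_perm s r (frame p q k)) /\ centers (- signed_perm s r (frame p q k)).
Proof.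
have p0 : 0 < p := lt_trans q0 qp.
apply: (standard_frame p q (lattice B)) => //.
- exact: latticeB.
- move=> _ _ [u Lu ->] [v Lv ->]; rewrite (_ : _ - _ = u - v); first exact: latticeB.
  by apply/colP => i; rewrite !mxE; ring.
- move=> x Lx xp; apply: contrapT => x0.
  have [||E|i] := tile_sep (a + 0) p (a + x) p p0 p0.
  + by apply/tile_p/lattice0.
  + exact: tile_p.
  + by have [/addrI /esym] := cube_inj _ _ _ _ (ltW p0) E.
  + by rewrite !mxE; have := xp i; rewrite ltr_norml => /andP[h1 h2] []; lra.
- move=> _ [v Lv ->] small.
  have [||E|i] := tile_sep (a + v) p (b + 0) q p0 q0.
  + exact: tile_p.
  + by apply/tile_q/lattice0.
  + have [_ E'] := cube_inj _ _ _ _ (ltW p0) E.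
    by move: qp; rewrite E' ltxx.
  + by have := small i; rewrite !mxE ltr_norml => /andP[h1 h2] []; lra.
move=> v s.
pose c (e : bool) := if e then a else b.
pose side (e : bool) := if e then p else q.
have [|x|[] [u Lu uP]] :=
    orthant_cover B c side B_unit _ _ (v + (b + const_mx (q / 2))) s.
- by case.
- have [_ [[u Lu [->|->]] xC]] := tiling.2.1 x; first by exists true, u.
  by exists false, u.
- right; exists (a + u + const_mx (p / 2) - (b + const_mx (q / 2))); first by exists u.
  move=> j; have := uP j; rewrite !mxE /=.
  by rewrite (_ : v j 0 - _ = v j 0 + (b j 0 + q / 2) - (a j 0 + u j 0) - p / 2) //; ring.
- left; exists u => // j; have := uP j; rewrite !mxE /=.
  by rewrite (_ : v j 0 - _ = v j 0 + (b j 0 + q / 2) - (b j 0 + u j 0) - q / 2) //; ring.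
Qed.

Lemma signed_permD s (r : {perm 'I_N.+1}) (x y : 'cV[R]_N.+1) :
  signed_perm s r (x + y) = signed_perm s r x + signed_perm s r y.
Proof. by apply/colP => i; rewrite !mxE mulrDr. Qed.

Lemma signed_permB s (r : {perm 'I_N.+1}) (x y : 'cV[R]_N.+1) :
  signed_perm s r (x - y) = signed_perm s r x - signed_perm s r y.
Proof. by apply/colP => i; rewrite !mxE mulrBr. Qed.

(** Every column of the standard matrix is a difference of centers of the form [frame] or its
    negative; this puts the image of the standard lattice inside the given one. *)
Lemma std_vec_unit (k : 'I_N.+1) : std_vec p q (fun i => (i == k)%:R) =
  if k == ord0 then frame p q ord0 + frame p q ord_max
  else frame p q k - frame p q (inord k.-1).
Proof.
have I (e : bool) : (e%:R : int)%:~R = e%:R :> R by case: e.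
apply/colP => j; rewrite std_vecE antiper_ord /antiper.
have [->|k0] := eqVneq k ord0.
  rewrite (_ : 1 *- true = - 1 :> int) // !mxE -!val_eqE /= ?I.
  case: ltnP => jN; first rewrite inordK // ?I.
    rewrite (ltn_eqF (jN : (j < N)%N)) [(N < j)%N]ltnNge (ltnW (jN : (j < N)%N)) /=.
    by case: (nat_of_ord j) => [|j'] /=; lra.
  have jE : nat_of_ord j = N by apply/eqP; rewrite eqn_leq -ltnS ltn_ord.
  by rewrite jE eqxx /=; case: N => [|N'] /=; lra.
have mK : nat_of_ord (inord k.-1 : 'I_N.+1) = k.-1.
  by rewrite inordK // (leq_ltn_trans (leq_pred _) (ltn_ord k)).
rewrite !mxE -!val_eqE /= mK; move: k0; rewrite -val_eqE /= => k0.
have kE : nat_of_ord k = k.-1.+1 by rewrite prednK // lt0n.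
have -> : (if (j.+1 < N.+1)%N then (nat_of_ord (inord j.+1 : 'I_N.+1) == k)%:R else 0) =
    (nat_of_ord j == k.-1)%:R :> int.
  case: ltnP => jN; first by rewrite inordK // kE eqSS.
  rewrite -eqSS -kE.
  by rewrite gtn_eqF // (leq_trans (ltn_ord k)).
rewrite !I kE /=; move: k.-1 => m.
case: (ltngtP j m) => jm.
- have -> : (nat_of_ord j == m.+1) = false by apply/negbTE; lia.
  have -> : (m.+1 < j)%N = false by apply/negbTE; lia.
  by rewrite /=; lra.
- case: (ltngtP j m.+1) => jm' /=; [by lia|lra|lra].
- have -> : (nat_of_ord j == m.+1) = false by apply/negbTE; lia.
  have -> : (m.+1 < j)%N = false by apply/negbTE; lia.
  by rewrite /=; lra.
Qed.

Lemma std_vec_lattice s (r : {perm 'I_N.+1}) :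
  (forall k, centers (signed_perm s r (frame p q k)) /\
             centers (- signed_perm s r (frame p q k))) ->
  forall z, lattice B (signed_perm s r (std_vec p q z)).
Proof.
move=> H.
have cB g h : centers g -> centers h -> lattice B (g - h).
  move=> [u Lu ->] [v Lv ->]; rewrite (_ : _ - _ = u - v); first exact: latticeB.
  by apply/colP => i; rewrite !mxE; ring.
have Lunit k : lattice B (signed_perm s r (std_vec p q (fun i => (i == k)%:R))).
  rewrite std_vec_unit; case: eqP => _.
    rewrite signed_permD -[X in _ + X]opprK; apply: cB; first by case: (H ord0).
    by case: (H ord_max).
  by rewrite signed_permB; apply: cB; [case: (H k)|case: (H (inord k.-1))].
pose P z := lattice B (signed_perm s r (std_vec p q z)).
have PB y z : P y -> P z -> P (fun i => y i - z i).
  by move=> Py Pz; rewrite /P std_vecB signed_permB; apply: latticeB.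
have PD y z : P y -> P z -> P (fun i => y i + z i).
  by move=> Py Pz; rewrite /P std_vecD signed_permD; apply: latticeD.
have P0 : P (fun=> 0).
  by have := PB _ _ (Lunit ord0) (Lunit ord0); congr P; apply/funext => i; rewrite subrr.
have Pm k (m : int) : P (fun i => m * (i == k)%:R).
  elim: m => [|m IH|m IH].
  - by move: P0; congr P; apply/funext => i; rewrite mul0r.
  - have := PD _ _ IH (Lunit k); congr P; apply/funext => i.
    by rewrite intS mulrDl mul1r addrC.
  - have := PB _ _ IH (Lunit k); congr P; apply/funext => i.
    by rewrite intS opprD mulrDl mulN1r addrC.
move=> z; suff Pk k : (k <= N.+1)%N -> P (fun i => if (i < k)%N then z i else 0).
  by have := Pk _ (leqnn _); congr P; apply/funext => i; rewrite ltn_ord.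
elim: k => [|k IH] kN; first exact: P0.
have := PD _ _ (IH (ltnW kN)) (Pm (Ordinal kN) (z (Ordinal kN))).
congr P; apply/funext => i; rewrite -val_eqE /= [(i < k.+1)%N]ltnS [(i <= k)%N]leq_eqVlt.
case: eqP => [ik|_] /=; last by rewrite mulr0 addr0.
have -> : Ordinal kN = i by apply/val_inj.
by rewrite ik ltnn add0r mulr1.
Qed.

(** A signed permutation about centers of q-cubes: [const_mx (q / 2)] is the center of the standard
    q-cube at the origin and goes to that of the cube at [b]. *)
Definition place s (r : {perm 'I_N.+1}) (x : 'cV[R]_N.+1) : 'cV[R]_N.+1 :=
  b + const_mx (q / 2) + signed_perm s r (x - const_mx (q / 2)).

Definition unplace s (r : {perm 'I_N.+1}) (y : 'cV[R]_N.+1) : 'cV[R]_N.+1 :=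
  const_mx (q / 2) +
  \col_k (sg (s ((r^-1)%g k)) * (y - (b + const_mx (q / 2))) ((r^-1)%g k) 0).

Lemma placeK s r : cancel (place s r) (unplace s r).
Proof.
move=> x; apply/colP => k.
have E : place s r x - (b + const_mx (q / 2)) = signed_perm s r (x - const_mx (q / 2)).
  by rewrite /place addrAC subrr add0r.
by rewrite /unplace E !mxE sgK permKV addrC subrK.
Qed.

Lemma unplaceK s r : cancel (unplace s r) (place s r).
Proof.
move=> y; apply/colP => k; rewrite /unplace /place [const_mx _ + \col__ _]addrC addrK.
by rewrite !mxE permK sgK addrC subrK.
Qed.

Lemma place_isometry s r : euclid_isometry (place s r).
Proof.
move=> x y; rewrite /sqdist [RHS](reindex_inj (@perm_inj _ r)).
apply: eq_bigr => i _; rewrite !mxE; case: (s i); rewrite /sg; ring.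
Qed.

Lemma unplace_isometry s r : euclid_isometry (unplace s r).
Proof. by move=> x y; rewrite -(place_isometry s r) !unplaceK. Qed.

(** Cubes are given by their centers because a reflection does not preserve lower corners. *)
Lemma place_cube s r c t :
  place s r @` cube (c - const_mx (t / 2)) t = cube (place s r c - const_mx (t / 2)) t.
Proof.
have D x i : place s r x i 0 - place s r c i 0 = sg (s i) * (x (r i) 0 - c (r i) 0).
  by rewrite !mxE; ring.
have V (u : 'cV[R]_N.+1) i : (u - const_mx (t / 2)) i 0 = u i 0 - t / 2 by rewrite !mxE.
apply/seteqP; split => [_ [x xc <-] i|y yc].
  by have := xc (r i); have := D x i; rewrite !V /sg; case: (s i); lra.
exists (unplace s r y); last exact: unplaceK.
move=> k; have := yc ((r^-1)%g k); have := D (unplace s r y) ((r^-1)%g k).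
by rewrite !V unplaceK permKV /sg; case: (s _); lra.
Qed.

Lemma std_corner_center e (z : 'I_N.+1 -> int) :
  std_corner p q e z = (if e then frame p q ord_max + const_mx (q / 2)
    else const_mx (q / 2)) + std_vec p q z - const_mx (std_side p q e / 2).
Proof.
apply/colP => j; rewrite /std_corner; case: e => /=; last by rewrite !mxE; lra.
rewrite !mxE; case: eqP => [_|/eqP jN]; first by lra.
rewrite ifF; first by lra.
by apply/negbTE; rewrite -leqNgt -ltnS ltn_ord.
Qed.

(** Images of standard tiles are tiles. Conversely, the image covering the center of a tile cannot
    be separated from that tile, so it is the same tile. *)
Lemma place_std_tiling : exists s r, maps_tiling (place s r) (std_tiling p q) cube_tiling.
Proof.
have [s [r H]] := tiling_frame; have Lz := std_vec_lattice s r H.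
have p0 : 0 < p := lt_trans q0 qp.
have sub D : std_tiling p q D -> cube_tiling (place s r @` D).
  move=> /std_tilingP[e [z ->]]; rewrite std_corner_center place_cube.
  case: e => /=.
    have [[v Lv E] _] := H ord_max.
    rewrite (_ : place s r _ - _ = a + (v + signed_perm s r (std_vec p q z))).
      exact/tile_p/latticeD.
    rewrite /place [frame _ _ _ + _ + _]addrAC addrK signed_permD E.
    by apply/colP => i; rewrite !mxE; ring.
  rewrite (_ : place s r _ - _ = b + signed_perm s r (std_vec p q z)); first exact: tile_q.
  rewrite /place [const_mx _ + std_vec _ _ _]addrC addrK.
  by apply/colP => i; rewrite !mxE; ring.
exists s, r; apply/seteqP; split => [_ [D FD <-]|C FC]; first exact: sub.
have [c [t [t0 CE]]] : exists c t, 0 < t /\ C = cube c t.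
  by case: FC => v _ [->|->]; [exists (a + v), p|exists (b + v), q].
pose x := c + const_mx (t / 2).
have [D [FD xD]] := (std_is_tiling p q q0 qp).2.1 (unplace s r x).
exists D => //; apply: contrapT => neq.
have FD' := sub _ FD.
have [d [u [u0 DE]]] : exists d u, 0 < u /\ place s r @` D = cube d u.
  by case: FD' => v _ [->|->]; [exists (a + v), p|exists (b + v), q].
have xd : cube d u x by rewrite -DE; exists (unplace s r x) => //; exact: unplaceK.
have [||E|i] := tile_sep c t d u t0 u0.
- by rewrite -CE.
- by rewrite -DE.
- by apply: neq; rewrite DE CE E.
- by have := xd i; rewrite !mxE; lra.
Qed.

End CubeTiling.

(** * Existence and uniqueness *)

Lemma lattice_cube_tiling_std {R : realType} {N : nat} (p q : R)
    (F : set (set 'cV[R]_N.+1)) :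
  0 < q -> q < p -> lattice_cube_tiling p q F ->
  exists f g, [/\ euclid_isometry f, euclid_isometry g, cancel f g &
    maps_tiling f (std_tiling p q) F].
Proof.
move=> q0 qp [B [_ [_ [Bu [[a ->] [[b ->] [FE tF]]]]]]].
have {}FE : F = cube_tiling p q B a b.
  rewrite FE; apply/seteqP; split=> C [v Lv];
    by rewrite ?translate_cube => h; exists v; rewrite ?translate_cube.
rewrite FE in tF *.
have [s [r m]] := place_std_tiling p q q0 qp B a b Bu tF.
exists (place q b s r), (unplace q b s r); split => //.
- exact: place_isometry.
- exact: unplace_isometry.
- exact: placeK.
Qed.

Lemma unique_lattice_cube_tiling {R : realType} {N : nat} (p q : R)
    (F G : set (set 'cV[R]_N.+1)) :
  0 < q -> q < p -> lattice_cube_tiling p q F -> lattice_cube_tiling p q G ->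
  exists f, euclid_isometry f /\ maps_tiling f F G.
Proof.
move=> q0 qp /(lattice_cube_tiling_std _ _ _ q0 qp)[f [f' [_ f'i f'K <-]]].
move=> /(lattice_cube_tiling_std _ _ _ q0 qp)[g [_ [gi _ _ <-]]].
exists (g \o f'); split=> [x y|]; first by rewrite /= gi f'i.
have E D : (g \o f') @` (f @` D) = g @` D.
  rewrite image_comp; apply: eq_imagel => x _ /=; by rewrite f'K.
apply/seteqP; split => [_ [_ [D FD <-] <-]|_ [D FD <-]].
  by exists D => //; rewrite E.
by exists (f @` D); [exists D|rewrite E].
Qed.

Lemma lattice_cube_tilingC {R : realType} {n : nat} (p q : R) (F : set (set 'cV[R]_n)) :
  lattice_cube_tiling p q F -> lattice_cube_tiling q p F.
Proof.
move=> [B [S [T [Bu [Sp [Tq [FE tF]]]]]]].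
exists B, T, S; split=> //; split=> //; split=> //; split=> //.
by rewrite FE; apply/seteqP; split=> C [v Lv h]; exists v => //; case: h; auto.
Qed.

Theorem theorem1 (R : realType) (n : nat) (p q : R) :
  (2 <= n)%N -> 0 < p -> 0 < q -> p != q ->
  (exists F : set (set 'cV[R]_n), lattice_cube_tiling p q F /\ unilateral F) /\
  (forall F G : set (set 'cV[R]_n),
     lattice_cube_tiling p q F -> unilateral F ->
     lattice_cube_tiling p q G -> unilateral G ->
     exists f : 'cV[R]_n -> 'cV[R]_n, euclid_isometry f /\ maps_tiling f F G).
Proof.
case: n => [//|N] N0 p0 q0; rewrite neq_lt => /orP[pq|qp].
  split; last by move=> F G /lattice_cube_tilingC tF _ /lattice_cube_tilingC tG _;
    exact: unique_lattice_cube_tiling tF tG.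
  exists (std_tiling q p); split; last exact: std_unilateral.
  by apply: lattice_cube_tilingC; exact: std_lattice_tiling.
split; last by move=> F G tF _ tG _; exact: unique_lattice_cube_tiling tF tG.
exists (std_tiling p q); split; last exact: std_unilateral.
exact: std_lattice_tiling.
Qed.
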